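(* Let $\sigma>0$ be fixed. Let $(p_n)$ be a sequence of integers with $0\le p_n\le n$, $p_n\to\infty$ and $p_n=o(n)$ as $n\to\infty$, and let $\tau=\tau_n\in(0,1)$ with $\tau_n\to 0$. Suppose that, under $\mathbb{E}_{\theta_0}$, $Y\sim\mathcal{N}(\theta_0,\sigma^2 I_n)$. Then the variance of the posterior distribution corresponding to the horseshoe prior with parameter $\tau$ satisfies, as $n\to\infty$, $$\sup_{\theta_0\in\ell_0[p_n]}\mathbb{E}_{\theta_0}\sum_{i=1}^n\mathrm{Var}(\theta_i\mid Y_i)\lesssim p_n\log\frac1\tau+(n-p_n)\,\tau\sqrt{\log\frac1\tau}.$$
   Context: $\ell_0[p_n]:=\{\theta\in\mathbb{R}^n:\#\{1\le i\le n:\theta_i\ne 0\}\le p_n\}$. $A_n\lesssim B_n$ means there is a constant $c>0$ independent of $n$ with $A_n\le cB_n$ (for all sufficiently large $n$). Horseshoe prior with fixed parameter $\tau>0$: the pairs $(\lambda_i,\theta_i)$, $i=1,\dots,n$, are independent, $\lambda_i$ has the standard half-Cauchy distribution $C^+(0,1)$ on $(0,\infty)$, and $\theta_i\mid\lambda_i\sim\mathcal{N}(0,\sigma^2\tau^2\lambda_i^2)$. The posterior is the conditional law of $\theta=(\theta_1,\dots,\theta_n)$ given $Y=y$ when $Y\mid\theta\sim\mathcal{N}(\theta,\sigma^2I_n)$; it factorizes over coordinates. $\mathrm{Var}(\theta_i\mid y_i)$ denotes the variance of the $i$-th coordinate under this posterior (with the given $\tau$). *)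

(* Defs.v *)
From HB Require Import structures.
From mathcomp Require Import all_boot all_order all_algebra.
From mathcomp Require Import all_classical all_reals all_analysis.
From mathcomp Require Import measurable_realfun.

Set Implicit Arguments.
Unset Strict Implicit.
Unset Printing Implicit Defensive.

Import Order.TTheory GRing.Theory Num.Theory.
Import numFieldNormedType.Exports.

Local Open Scope classical_set_scope.
Local Open Scope ring_scope.

Section half_cauchy.
Variable R : realType.
Local Notation mu := lebesgue_measure.
Local Notation bR := (measurableTypeR R).

Definition half_cauchy_pdf (x : R) : R :=
  if 0 < x then 2 / (pi * (1 + x ^+ 2)) else 0.

Definition half_cauchy_prob (A : set bR) : \bar R :=
  (\int[mu]_(x in A) (half_cauchy_pdf x)%:E)%E.

Lemma half_cauchy_pdf_ge0 x : 0 <= half_cauchy_pdf x.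
Proof.
rewrite /half_cauchy_pdf; case: ifPn => // _.
by rewrite divr_ge0// mulr_ge0 ?pi_ge0// addr_ge0// sqr_ge0.
Qed.

Let pdf1 (x : R) : R := 2 / pi * (oneDsqr x)^-1.

Let pdf1_continuous : continuous pdf1.
Proof.
move=> x; apply: cvgM; first exact: cvg_cst.
exact: continuous_oneDsqrV.
Qed.

Let half_cauchy_pdfE x : half_cauchy_pdf x = if 0 < x then pdf1 x else 0.
Proof. by rewrite /half_cauchy_pdf /pdf1 /oneDsqr invfM mulrA. Qed.

Lemma measurable_half_cauchy_pdf : measurable_fun [set: R] half_cauchy_pdf.
Proof.
rewrite (funext half_cauchy_pdfE).
apply: measurable_fun_ifT => //=; first exact: measurable_fun_ltr.
exact: continuous_measurable_fun.
Qed.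

Lemma integral_half_cauchy_pdf : (\int[mu]_x (half_cauchy_pdf x)%:E = 1)%E.
Proof.
transitivity (\int[mu]_(x in `]0%R, +oo[) (pdf1 x)%:E)%E.
  rewrite [RHS]integral_mkcond; apply: eq_integral => x _.
  rewrite patchE half_cauchy_pdfE mem_setE in_itv/= andbT.
  by case: ifPn.
rewrite integral_itv_obnd_cbnd; last first.
  apply/measurable_EFinP/measurable_funTS.
  exact: continuous_measurable_fun.
rewrite (@ge0_continuous_FTC2y _ pdf1 (fun x => 2 / pi * atan x) _ 1).
- by rewrite atan0 mulr0 sube0.
- by move=> x _; rewrite /pdf1 mulr_ge0// ?invr_ge0 ?divr_ge0 ?pi_ge0// /oneDsqr addr_ge0// sqr_ge0.
- exact: continuous_subspaceT.
- rewrite [X in _ --> X](_ : _ = 2 / pi * (pi / 2)).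
    by apply: cvgMr => //; exact: cvgy_atan.
  by rewrite mulrA divfK ?divff ?gt_eqF ?pi_gt0.
- by move=> x _; apply: derivableM => //.
- by apply: cvg_at_right_filter; apply: cvgMr => //; exact: continuous_atan.
- move=> x _; rewrite derive1Ml //.
  by rewrite derive1_atan.
Qed.

Let half_cauchy0 : half_cauchy_prob set0 = 0%E.
Proof. by rewrite /half_cauchy_prob integral_set0. Qed.

Let half_cauchy_ge0 A : (0 <= half_cauchy_prob A)%E.
Proof. by apply: integral_ge0 => x _; rewrite lee_fin half_cauchy_pdf_ge0. Qed.

Let half_cauchy_sigma_additive : semi_sigma_additive half_cauchy_prob.
Proof.
move=> F mF tF mUF; rewrite /half_cauchy_prob ge0_integral_bigcup//=.
- apply: is_cvg_ereal_nneg_natsum_cond => n _ _.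
  by apply: integral_ge0 => x _; rewrite lee_fin half_cauchy_pdf_ge0.
- by apply/measurable_EFinP/measurable_funTS; exact: measurable_half_cauchy_pdf.
- by move=> x _; rewrite lee_fin half_cauchy_pdf_ge0.
Qed.

HB.instance Definition _ := isMeasure.Build _ _ _ half_cauchy_prob
  half_cauchy0 half_cauchy_ge0 half_cauchy_sigma_additive.

HB.instance Definition _ := Measure_isProbability.Build _ _ _ half_cauchy_prob
  integral_half_cauchy_pdf.

End half_cauchy.

Section product_probability.
Context d1 d2 (T1 : measurableType d1) (T2 : measurableType d2) (R : realType).
Variables (P : probability T1 R) (Q : probability T2 R).
Local Open Scope ereal_scope.

Definition prod_prob : set (T1 * T2) -> \bar R := P \x Q.

HB.instance Definition _ := Measure.on prod_prob.

Let prod_prob_setT : prod_prob setT = 1.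
Proof.
rewrite -setXTT [LHS]product_measure1E//.
by rewrite [X in X * _]probability_setT [X in _ * X]probability_setT mule1.
Qed.

HB.instance Definition _ :=
  Measure_isProbability.Build _ _ _ prod_prob prod_prob_setT.

End product_probability.

Section tuple_probability.
Context d (T : measurableType d) (R : realType).

Definition cons_tuple n (x : T * n.-tuple T) : n.+1.-tuple T :=
  [tuple of x.1 :: x.2].

Lemma measurable_cons_tuple n :
  measurable_fun [set: T * n.-tuple T] (@cons_tuple n).
Proof. exact: measurable_cons. Qed.

HB.instance Definition _ n :=
  isMeasurableFun.Build _ _ _ _ (@cons_tuple n) (@measurable_cons_tuple n).

(* Law of n independent coordinates, the i-th one with law P i
   (see tuple_prob_box). *)
Fixpoint tuple_prob n : ('I_n -> probability T R) -> probability (n.-tuple T) R :=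
  match n with
  | 0 => fun=> \d_([tuple])
  | n.+1 => fun P =>
      distribution (prod_prob (P ord0) (tuple_prob (fun i => P (lift ord0 i))))
        (@cons_tuple n)
  end.

Lemma tuple_prob_box n (P : 'I_n -> probability T R) (A : 'I_n -> set T) :
  (forall i, measurable (A i)) ->
  tuple_prob P [set t | forall i, A i (tnth t i)] = (\prod_(i < n) P i (A i))%E.
Proof.
elim: n P A => [|n IH] P A mA /=.
  rewrite big_ord0 (_ : [set _ | _] = setT) ?diracT//.
  by apply/seteqP; split => // t _ [].
rewrite big_ord_recl -IH; last by move=> i; exact: mA.
rewrite /distribution /pushforward /prod_prob/= -product_measure1E//.
  congr (_ _); apply/seteqP; split => -[x t] /=.
    move=> h; split; first exact: (h ord0).
    by move=> i; have := h (lift ord0 i); rewrite tnthS.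
  move=> [Ax At] i; case: (unliftP ord0 i) => [j ->|->//].
  by rewrite tnthS.
rewrite (_ : [set _ | _] = \big[setI/setT]_(i < n)
  (fun t : n.-tuple T => tnth t i) @^-1` A (lift ord0 i)).
  apply: bigsetI_measurable => i _.
  by rewrite -[X in measurable X]setTI; apply: measurable_tnth => //; exact: mA.
rewrite -bigcap_seq; apply/seteqP; split => t/= h i.
  by move=> _; exact: h.
by apply: h; rewrite /= mem_index_enum.
Qed.

End tuple_probability.

Section measurable_normal_pdf.
Variable R : realType.

Lemma measurable_invr_ge0 d (T : measurableType d) (f : T -> R) :
  (forall t, 0 <= f t)%R -> measurable_fun setT f ->
  measurable_fun setT (fun t => (f t)^-1)%R.
Proof.
move=> f0 mf; rewrite (_ : (fun _ => _) = (@powR R ^~ (-1)%R) \o f).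
  by apply: measurableT_comp => //; exact: measurable_powR.
by apply/funext => t /=; rewrite powR_inv1.
Qed.

Lemma measurable_normal_pdf3 d (T : measurableType d) (m s x : T -> R) :
  measurable_fun setT m -> measurable_fun setT s -> measurable_fun setT x ->
  measurable_fun setT (fun t => normal_pdf (m t) (s t) (x t)).
Proof.
move=> mm ms mx; rewrite /normal_pdf.
apply: measurable_fun_ifT => //.
- by apply: measurable_fun_eqr => //.
- exact: measurableT_comp.
- rewrite /normal_peak /normal_fun.
  rewrite (_ : (fun _ => _) = fun t => (Num.sqrt (s t ^+ 2 * (pi * 2)))^-1 *
    expR (- (x t - m t) ^+ 2 * (s t ^+ 2 * 2)^-1)); last first.
    by apply/funext => t; rewrite !mulr_natr mulrnAr.
  have ms2 (c : R) : measurable_fun setT (fun t => s t ^+ 2 * c)%R.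
    by apply: measurable_funM => //; exact: measurable_funX.
  apply: measurable_funM.
    apply: measurable_invr_ge0 => [t|]; first exact: sqrtr_ge0.
    apply: measurableT_comp => /=.
      by apply: continuous_measurable_fun; exact: sqrt_continuous.
    exact: ms2.
  apply: measurableT_comp => //; apply: measurable_funM.
    apply: measurableT_comp => //; apply: measurable_funX.
    exact: measurable_funB.
  apply: measurable_invr_ge0 => [t|]; last exact: ms2.
  by rewrite mulr_ge0 ?sqr_ge0.
Qed.

End measurable_normal_pdf.

Section horseshoe_prior.
Variable R : realType.
Local Notation mu := lebesgue_measure.
Local Notation bR := (measurableTypeR R).
Local Open Scope ereal_scope.

(* N(m, s^2): as in the library, s is the standard deviation. *)
Definition gaussian (m s : R) : probability bR R := normal_prob m s.
Definition half_cauchy : probability bR R := @half_cauchy_prob R.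

Section pair.
Variables s t : R.

(* Joint law of (lambda_i, theta_i): lambda_i is half-Cauchy and, given
   lambda_i = l, theta_i has law N(0, (s t l)^2). *)
Definition horseshoe_pair (A : set (bR * bR)) : \bar R :=
  \int[half_cauchy]_l gaussian 0 (s * t * l) (xsection A l).

Let measurable_section A : measurable A ->
  measurable_fun setT (fun l : bR => gaussian 0 (s * t * l) (xsection A l)).
Proof.
move=> mA.
pose f (z : bR * bR) : \bar R :=
  (normal_pdf 0 (s * t * z.1) z.2 * \1_A z)%:E.
rewrite (_ : (fun _ => _) = fubini_F mu f).
  apply: measurable_fun_fubini_tonelli_F => //=.
  - apply/measurable_EFinP/measurable_funM; last exact: measurable_indic.
    apply: measurable_normal_pdf3 => //.
    exact: measurable_funM.
  - by move=> z; rewrite lee_fin mulr_ge0 ?normal_pdf_ge0.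
apply/funext => l; rewrite /gaussian /normal_prob /= /fubini_F [LHS]integral_mkcond.
apply: eq_integral => x _; rewrite patchE /f /= indicE mem_xsection.
by case: ifPn => //=; rewrite ?mulr1 ?mulr0.
Qed.

Let pair0 : horseshoe_pair set0 = 0.
Proof. by apply: integral0_eq => l _; rewrite xsection0 measure0. Qed.

Let pair_ge0 A : 0 <= horseshoe_pair A.
Proof. exact: integral_ge0. Qed.

Let pair_sigma_additive : semi_sigma_additive horseshoe_pair.
Proof.
move=> F mF tF mUF; rewrite /horseshoe_pair.
rewrite (_ : \int[_]_l _ = \sum_(0 <= n <oo) horseshoe_pair (F n)).
  apply: is_cvg_ereal_nneg_natsum_cond => n _ _; exact: pair_ge0.
rewrite -integral_nneseries//; last by move=> n; exact: measurable_section.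
apply: eq_integral => l _; rewrite xsection_bigcup measure_semi_bigcup//.
- by move=> n; exact: measurable_xsection.
- exact: trivIset_xsection.
- by apply: bigcup_measurable => n _; exact: measurable_xsection.
Qed.

HB.instance Definition _ := isMeasure.Build _ _ _ horseshoe_pair
  pair0 pair_ge0 pair_sigma_additive.

Let pair_setT : horseshoe_pair setT = 1.
Proof.
rewrite /horseshoe_pair (eq_integral (cst 1)).
  by rewrite integral_cst// mul1e; exact: (probability_setT half_cauchy).
by move=> l _; rewrite -setXTT in_xsectionX ?inE//; exact: (probability_setT (gaussian _ _)).
Qed.

HB.instance Definition _ := Measure_isProbability.Build _ _ _ horseshoe_pair
  pair_setT.

End pair.

End horseshoe_prior.

Section density.
Context d (T : measurableType d) (R : realType).
Variables (P Q : {measure set T -> \bar R}) (g : T -> R).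
Hypothesis g0 : forall x, 0 <= g x.
Hypothesis mg : measurable_fun setT g.
Local Open Scope ereal_scope.
Hypothesis PQ : forall A, measurable A -> P A = \int[Q]_(x in A) (g x)%:E.

Import HBNNSimple.

Lemma ge0_integral_density (f : T -> \bar R) : measurable_fun setT f ->
  (forall x, 0 <= f x) -> \int[P]_x f x = \int[Q]_x (f x * (g x)%:E).
Proof.
move=> mf f0; pose f_ := nnsfun_approx measurableT mf.
transitivity (limn (fun n => \int[P]_x (f_ n x)%:E)).
  rewrite -monotone_convergence//.
  - by apply: eq_integral => y _; apply/esym/cvg_lim => //; exact: cvg_nnsfun_approx.
  - by move=> n; exact/measurable_EFinP/measurable_funP.
  - by move=> n y _; rewrite lee_fin.
  - by move=> y _ m n mn; rewrite lee_fin; exact/lefP/nd_nnsfun_approx.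
transitivity (limn (fun n => \int[Q]_x ((f_ n x)%:E * (g x)%:E))); last first.
  rewrite -monotone_convergence//.
  - apply: eq_integral => y _; apply/cvg_lim => //; apply: cvgeZr => //.
    exact: cvg_nnsfun_approx.
  - move=> n; apply: emeasurable_funM; last exact/measurable_EFinP.
    exact/measurable_EFinP/measurable_funP.
  - by move=> n y _; rewrite mule_ge0 ?lee_fin.
  - move=> y _ m n mn; apply: lee_wpmul2r; rewrite lee_fin//.
    exact/lefP/nd_nnsfun_approx.
congr (limn _); apply/funext => n; rewrite integralT_nnsfun sintegralE.
transitivity (\sum_(k \in range (f_ n))
    \int[Q]_x (k%:E * (\1_(f_ n @^-1` [set k]) x * g x)%:E)).
  apply: eq_fsbigr => r _.
  have [r0|r0] := ltP r 0%R.
    rewrite preimage_nnfun0// measure0 mule0 integral0_eq// => x _.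
    by rewrite indic0 mul0r mule0.
  rewrite PQ// ge0_integralZl//=.
  - rewrite integral_mkcond; congr (_ * _); apply: eq_integral => x _.
    by rewrite patchE indicE; case: ifPn; rewrite ?mul1r ?mul0r.
  - by apply/measurable_EFinP/measurable_funM.
  - by move=> x _; rewrite lee_fin mulr_ge0.
rewrite -ge0_integral_fsum//.
- apply: eq_integral => x _.
  rewrite -EFinM [in RHS]fimfunE mulr_fsuml -fsumEFin//.
  by apply: eq_fsbigr => r _; rewrite -EFinM mulrA.
- by move=> r; apply/measurable_EFinP/measurable_funM => //; exact: measurable_funM.
- move=> r x _; rewrite -EFinM mulrA EFinM mule_ge0 ?lee_fin//.
  by rewrite -lee_fin EFinM nnfun_muleindic_ge0.
Qed.

End density.

Section tuple_density.
Context d (T : measurableType d) (R : realType).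
Local Open Scope ereal_scope.

Lemma tuple_prob_density n (P Q : 'I_n -> probability T R) (g : 'I_n -> T -> R) :
  (forall i x, 0 <= g i x)%R -> (forall i, measurable_fun setT (g i)) ->
  (forall i A, measurable A -> P i A = \int[Q i]_(x in A) (g i x)%:E) ->
  forall A, measurable A -> tuple_prob P A =
    \int[tuple_prob Q]_(t in A) (\prod_(i < n) g i (tnth t i))%:E.
Proof.
elim: n P Q g => [|n IH] P Q g g0 mg PQ A mA.
  rewrite /= integral_dirac//; last first.
    by apply/measurable_EFinP/measurable_funTS/measurable_prod => -[].
  by rewrite big_ord0 mule1.
pose h n (g : 'I_n -> T -> R) (t : n.-tuple T) := (\prod_(i < n) g i (tnth t i))%R.
have mh m (k : 'I_m -> T -> R) : (forall i, measurable_fun setT (k i)) ->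
    measurable_fun setT (h m k).
  move=> mk; apply: measurable_prod => i _.
  by apply: measurableT_comp => //; exact: measurable_tnth.
have h0 m (k : 'I_m -> T -> R) : (forall i x, 0 <= k i x)%R -> forall t, (0 <= h m k t)%R.
  by move=> k0 t; apply: prodr_ge0.
pose g' i := g (lift ord0 i).
pose P' i := P (lift ord0 i).
pose Q' i := Q (lift ord0 i).
have {}IH := IH P' Q' g' (fun i => g0 _) (fun i => mg _) (fun i => PQ _).
have mcA : measurable (@cons_tuple _ T n @^-1` A).
  by rewrite -[X in measurable X]setTI; exact: measurable_cons_tuple.
transitivity (\int[P ord0]_x tuple_prob P' (xsection (@cons_tuple _ T n @^-1` A) x)).
  by [].
pose F (z : T * n.-tuple T) := (\1_(@cons_tuple _ T n @^-1` A) z * h n g' z.2)%:E.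
have mF : measurable_fun setT F.
  apply/measurable_EFinP/measurable_funM; first exact: measurable_indic.
  by apply: measurableT_comp => //; apply: mh => i; exact: mg.
have F0 z : 0 <= F z.
  by rewrite lee_fin mulr_ge0 ?h0// => i x; exact: g0.
rewrite (ge0_integral_density (g0 ord0) (mg ord0) (PQ ord0))//; last first.
  exact: measurable_fun_xsection.
rewrite [RHS]/= [RHS](_ : _ = \int[prod_prob (Q ord0) (tuple_prob Q')]_z ((g ord0 z.1)%:E * F z)).
  rewrite /prod_prob fubini_tonelli1//=; last 2 first.
  - apply: emeasurable_funM => //; apply/measurable_EFinP.
    exact: measurableT_comp.
  - move=> z; apply: mule_ge0; last exact: F0.
    by rewrite lee_fin; exact: g0.
  apply: eq_integral => x _; rewrite IH; last exact: measurable_xsection.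
  rewrite /fubini_F/= ge0_integralZl//=; last 2 first.
  - by apply: measurableT_comp => //; exact: pair1_measurable.
  - by rewrite lee_fin.
  rewrite muleC integral_mkcond; congr (_ * _); apply: eq_integral => t _.
  rewrite patchE /F/= indicE -mem_xsection.
  by case: ifPn; rewrite ?mul1r ?mul0r.
rewrite ge0_integral_pushforward//; last 2 first.
- by apply/measurable_EFinP/measurable_funTS; exact: (mh _ g).
- by move=> t _; rewrite lee_fin; exact: h0.
rewrite integral_mkcond; apply: eq_integral => z _.
rewrite patchE /F indicE; case: ifPn; rewrite ?mul0r ?mule0// mul1r => _ /=.
rewrite -EFinM /h big_ord_recl; congr (_ * _)%:E.
by apply: eq_bigr => i _; rewrite tnthS.
Qed.

End tuple_density.

Section posterior.
Variable R : realType.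
Local Notation bR := (measurableTypeR R).
Variables (n : nat) (s : R).
Local Open Scope ereal_scope.

Definition gaussian_tuple (theta : n.-tuple bR) : probability (n.-tuple bR) R :=
  tuple_prob (fun i => gaussian (tnth theta i) s).

Definition likelihood (y theta : n.-tuple bR) : R :=
  (\prod_(i < n) normal_pdf (tnth theta i) s (tnth y i))%R.

Lemma likelihood_ge0 y theta : (0 <= likelihood y theta)%R.
Proof. by apply: prodr_ge0 => i _; exact: normal_pdf_ge0. Qed.

Lemma measurable_likelihood :
  measurable_fun setT (fun z : n.-tuple bR * n.-tuple bR => likelihood z.1 z.2).
Proof.
apply: measurable_prod => i _; apply: measurable_normal_pdf3 => //.
- by apply: (measurableT_comp (measurable_tnth i)).
- by apply: (measurableT_comp (measurable_tnth i)).
Qed.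

Variable prior : probability (n.-tuple bR) R.

Section fix_y.
Variable y : n.-tuple bR.

Definition unnormalized_posterior (A : set (n.-tuple bR)) : \bar R :=
  \int[prior]_(theta in A) (likelihood y theta)%:E.

Let mlik : measurable_fun setT (EFin \o likelihood y).
Proof.
apply/measurable_EFinP.
exact: (measurableT_comp measurable_likelihood (pair1_measurable y)).
Qed.

Let bayes0 : unnormalized_posterior set0 = 0. Proof. exact: integral_set0. Qed.

Let bayes_ge0 A : 0 <= unnormalized_posterior A.
Proof. by apply: integral_ge0 => theta _; rewrite lee_fin likelihood_ge0. Qed.

Let bayes_sigma_additive : semi_sigma_additive unnormalized_posterior.
Proof.
move=> F mF tF mUF; rewrite /unnormalized_posterior ge0_integral_bigcup//=.
- by apply: is_cvg_ereal_nneg_natsum_cond => k _ _; exact: bayes_ge0.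
- exact/measurable_funTS.
- by move=> x _; rewrite lee_fin likelihood_ge0.
Qed.

HB.instance Definition _ := isMeasure.Build _ _ _ unnormalized_posterior
  bayes0 bayes_ge0 bayes_sigma_additive.

(* Bayes' formula; it is a version of the conditional law of theta given Y = y
   (posterior_disintegration), and for s != 0 the default value [prior] of
   mnormalize is never used (posteriorE). *)
Definition posterior : probability (n.-tuple bR) R :=
  mnormalize unnormalized_posterior prior.

Lemma evidence_gt0 : s != 0%R -> 0 < unnormalized_posterior setT.
Proof.
move=> s0; rewrite lt_neqAle bayes_ge0 andbT eq_sym; apply/negP => /eqP b0.
have /ae_eq_integral_abs /= h : measurable_fun setT (EFin \o likelihood y) := mlik.
have : \int[prior]_x `|(EFin \o likelihood y) x| = 0.
  by rewrite -b0; apply: eq_integral => x _; rewrite /= ger0_norm// likelihood_ge0.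
move/(h prior measurableT) => [N [mN N0 hN]].
have : prior setT <= prior N.
  apply: le_measure; rewrite ?inE// => x _; apply: hN => /= /(_ I) [].
  apply/eqP; rewrite gt_eqF// /likelihood prodr_gt0// => i _.
  by rewrite normal_pdfE// mulr_gt0 ?expR_gt0// normal_peak_gt0.
by rewrite N0 probability_setT lee_fin ler10.
Qed.

Lemma evidence_lty : s != 0%R -> unnormalized_posterior setT < +oo.
Proof.
move=> s0; apply: (@le_lt_trans _ _ (\int[prior]_x (normal_peak s ^+ n)%:E)).
  apply: ge0_le_integral => //=.
  - by move=> x _; rewrite lee_fin likelihood_ge0.
  - move=> x _; rewrite lee_fin /likelihood.
    rewrite -[X in (_ <= _ ^+ X)%R](card_ord n) -prodr_const.
    by apply: ler_prod => i _; rewrite normal_pdf_ge0 normal_pdf_ub.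
by rewrite integral_cst// [X in _ * X]probability_setT mule1 ltry.
Qed.

Lemma posteriorE A : s != 0%R ->
  posterior A =
  unnormalized_posterior A * ((fine (unnormalized_posterior setT))^-1)%:E.
Proof.
move=> s0; have b0 := evidence_gt0 s0; have b1 := evidence_lty s0.
by rewrite /posterior /= /mnormalize ifF// (gt_eqF b0) (lt_eqF b1).
Qed.

End fix_y.

(* With theta ~ prior and Y | theta ~ N(theta, s^2 I_n), this reads
   E[1_B(Y) posterior(Y)(A)] = P(theta \in A, Y \in B). *)
Lemma posterior_disintegration A B : s != 0%R -> measurable A -> measurable B ->
  \int[prior]_theta \int[gaussian_tuple theta]_(y in B) posterior y A =
  \int[prior]_(theta in A) gaussian_tuple theta B.
Proof.
move=> s0 mA mB.
pose Q := tuple_prob (fun _ : 'I_n => gaussian 0 s).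
pose r (theta y : n.-tuple bR) : R :=
  (\prod_(i < n) (normal_pdf (tnth theta i) s (tnth y i) / normal_pdf 0 s (tnth y i)))%R.
pose l0 (y : n.-tuple bR) : R := (\prod_(i < n) normal_pdf 0 s (tnth y i))%R.
have pdf_gt0 m x : (0 < normal_pdf m s x)%R.
  by rewrite normal_pdfE// mulr_gt0 ?expR_gt0// normal_peak_gt0.
have l0_gt0 y : (0 < l0 y)%R by apply: prodr_gt0.
have rE theta y : r theta y = (likelihood y theta * (l0 y)^-1)%R.
  by rewrite /r big_split prodfV.
have r0 theta y : (0 <= r theta y)%R.
  by rewrite rE mulr_ge0 ?likelihood_ge0// invr_ge0 ltW.
have ml0 : measurable_fun setT l0.
  apply: measurable_prod => i _.
  apply: (measurable_normal_pdf3 (m := cst 0%R) (s := cst s)) => //.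
  exact: measurable_tnth.
have mr : measurable_fun setT (fun z : n.-tuple bR * n.-tuple bR => r z.1 z.2).
  under eq_fun do rewrite rE.
  apply: measurable_funM.
    have h := measurableT_comp measurable_likelihood (@measurable_swap _ _ (n.-tuple bR) (n.-tuple bR)).
    exact: h.
  apply: (@measurableT_comp _ _ _ _ _ _ (fun y => (l0 y)^-1%R)) => //.
  by apply: measurable_invr_ge0 => // y; exact: ltW.
have mr1 theta : measurable_fun setT (r theta).
  exact: (measurableT_comp mr (pair1_measurable theta)).
have densPQ theta C : measurable C ->
    gaussian_tuple theta C = \int[Q]_(y in C) (r theta y)%:E.
  move=> mC; pose g (i : 'I_n) x := (normal_pdf (tnth theta i) s x / normal_pdf 0 s x)%R.
  have g0 i x : (0 <= g i x)%R by rewrite divr_ge0 ?normal_pdf_ge0.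
  have mg i : measurable_fun setT (g i : bR -> R).
    apply: measurable_funM; first exact: measurable_normal_pdf.
    apply: measurable_invr_ge0; first by move=> x; exact: normal_pdf_ge0.
    exact: measurable_normal_pdf.
  apply: (@tuple_prob_density _ bR R n _ (fun=> gaussian 0 s) g) => // i D mD.
  rewrite [RHS]integral_mkcond.
  rewrite (@ge0_integral_density _ _ _ _ (@lebesgue_measure R) (normal_pdf 0 s))//.
  - rewrite [LHS]integral_mkcond; apply: eq_integral => x _.
    rewrite !patchE; case: ifPn => // _; last by rewrite mul0e.
    by rewrite -EFinM divfK// gt_eqF.
  - by move=> x; rewrite normal_pdf_ge0.
  - exact: measurable_normal_pdf.
  - by apply/(measurable_restrictT _ mD)/measurable_funTS/measurable_EFinP.
  - by apply: erestrict_ge0 => x _; rewrite lee_fin.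
have bayesE y C : measurable C ->
    unnormalized_posterior y C = \int[prior]_theta (\1_C theta * likelihood y theta)%:E.
  move=> mC; rewrite /unnormalized_posterior integral_mkcond; apply: eq_integral => x _.
  by rewrite patchE indicE; case: ifPn; rewrite ?mul1r ?mul0r.
have rintE y C : measurable C ->
    \int[prior]_theta (\1_C theta * r theta y)%:E = unnormalized_posterior y C * ((l0 y)^-1)%:E.
  move=> mC; rewrite bayesE// muleC -ge0_integralZl//.
  - by apply: eq_integral => x _; rewrite -EFinM rE mulrA mulrC.
  - apply/measurable_EFinP/measurable_funM; first exact: measurable_indic.
    exact: (measurableT_comp measurable_likelihood (pair1_measurable y)).
  - by move=> x _; rewrite lee_fin mulr_ge0 ?likelihood_ge0.
  - by rewrite lee_fin invr_ge0 ltW.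
have mbayes C : measurable C -> measurable_fun setT (unnormalized_posterior ^~ C).
  move=> mC; rewrite (_ : unnormalized_posterior ^~ C = fubini_F prior
      (fun z => (\1_C z.2 * likelihood z.1 z.2)%:E)); last first.
    by apply/funext => y; rewrite bayesE.
  apply: measurable_fun_fubini_tonelli_F => //.
  - apply/measurable_EFinP/measurable_funM; last exact: measurable_likelihood.
    exact: (measurableT_comp (measurable_indic mC)).
  - by move=> z; rewrite lee_fin mulr_ge0 ?likelihood_ge0.
have mpost : measurable_fun setT (fun y => posterior y A).
  under eq_fun do rewrite posteriorE//.
  apply: emeasurable_funM; first exact: mbayes.
  apply/measurable_EFinP; apply: measurable_invr_ge0.
    by move=> y; exact/fine_ge0/measure_ge0.
  apply: (measurableT_comp _ (mbayes _ measurableT)) => //.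
pose w y := posterior y A * (\1_B y)%:E.
have w0 y : 0 <= w y by rewrite mule_ge0// lee_fin.
have mw : measurable_fun setT w.
  apply: emeasurable_funM => //; apply/measurable_EFinP; exact: measurable_indic.
transitivity (\int[prior]_theta \int[Q]_y (w y * (r theta y)%:E)).
  apply: eq_integral => theta _.
  rewrite -(ge0_integral_density (r0 theta) (mr1 theta) (densPQ theta) mw w0).
  rewrite [LHS]integral_mkcond; apply: eq_integral => y _.
  by rewrite patchE /w indicE; case: ifPn; rewrite ?mule1 ?mule0.
rewrite (fubini_tonelli (fun z => w z.2 * (r z.1 z.2)%:E)); last 2 first.
- apply: emeasurable_funM; last exact/measurable_EFinP.
  exact: (measurableT_comp mw).
- by move=> z; rewrite mule_ge0// lee_fin.
transitivity (\int[Q]_y \int[prior]_theta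
    (\1_A theta * (\1_B y * r theta y))%:E); last first.
  rewrite -(fubini_tonelli (fun z => (\1_A z.1 * (\1_B z.2 * r z.1 z.2))%:E)).
  - rewrite [RHS]integral_mkcond; apply: eq_integral => theta _.
    rewrite patchE /= indicE; case: ifPn => _.
      rewrite densPQ// [RHS]integral_mkcond; apply: eq_integral => y _.
      by rewrite patchE indicE mul1r; case: ifPn; rewrite ?mul1r ?mul0r.
    by rewrite integral0_eq// => y _; rewrite mul0r.
  - apply/measurable_EFinP/measurable_funM.
      exact: (measurableT_comp (measurable_indic mA)).
    apply: measurable_funM => //.
    exact: (measurableT_comp (measurable_indic mB)).
  - by move=> z; rewrite lee_fin !mulr_ge0.
apply: eq_integral => y _.
transitivity (w y * (unnormalized_posterior y setT * ((l0 y)^-1)%:E)).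
  rewrite -rintE// -ge0_integralZl//.
  - by apply: eq_integral => x _; rewrite indicT mul1r.
  - apply/measurable_EFinP/measurable_funM; first exact: measurable_indic.
    exact: (measurableT_comp mr (pair2_measurable y)).
  - by move=> x _; rewrite lee_fin mulr_ge0.
transitivity ((\1_B y)%:E * (unnormalized_posterior y A * ((l0 y)^-1)%:E)); last first.
  rewrite -rintE// -ge0_integralZl//.
  - by apply: eq_integral => x _; rewrite -EFinM mulrCA.
  - apply/measurable_EFinP/measurable_funM; first exact: measurable_indic.
    exact: (measurableT_comp mr (pair2_measurable y)).
  - by move=> x _; rewrite lee_fin mulr_ge0.
have b0 := evidence_gt0 y s0; have b1 := evidence_lty y s0.
have bfin : unnormalized_posterior y setT \is a fin_num by rewrite ge0_fin_numE// ltW.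
have vb : ((fine (unnormalized_posterior y setT))^-1)%:E * unnormalized_posterior y setT = 1.
  by rewrite -{2}(fineK bfin) -EFinM mulVf// gt_eqF// fine_gt0// b0.
rewrite /w posteriorE// [X in X * _]muleC -[LHS]muleA; congr (_ * _).
by rewrite -muleA [X in _ * X]muleA vb mul1e.
Qed.

End posterior.

Section horseshoe.
Variables (R : realType) (n : nat).
Local Notation bR := (measurableTypeR R).

Definition tuple_snd (z : n.-tuple (bR * bR)) : n.-tuple bR :=
  [tuple (tnth z i).2 | i < n].

Lemma measurable_tuple_snd : measurable_fun setT tuple_snd.
Proof.
apply/measurable_fun_tnthP => i.
rewrite (_ : _ \o _ = snd \o (fun z : n.-tuple (bR * bR) => tnth z i)).
  exact: (measurableT_comp measurable_snd (measurable_tnth i)).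
by apply/funext => z; rewrite /= tnth_mktuple.
Qed.

HB.instance Definition _ :=
  isMeasurableFun.Build _ _ _ _ tuple_snd measurable_tuple_snd.

Definition horseshoe_prior (sigma tau : R) : probability (n.-tuple bR) R :=
  distribution (tuple_prob (fun=> horseshoe_pair sigma tau)) tuple_snd.

Definition horseshoe_posterior (sigma tau : R) (y : n.-tuple bR) :
    probability (n.-tuple bR) R :=
  posterior sigma (horseshoe_prior sigma tau) y.

Definition ell0 (p : nat) : set (n.-tuple bR) :=
  [set theta | (#|[pred i | tnth theta i != 0%R :> R]| <= p)%N].

End horseshoe.

(* Main.v *)
Require Import Defs.
From HB Require Import structures.
From mathcomp Require Import all_boot all_order all_algebra.
From mathcomp Require Import all_classical all_reals all_analysis.
From mathcomp Require Import measurable_realfun ring lra.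
Set Implicit Arguments.
Unset Strict Implicit.
Unset Printing Implicit Defensive.
Import Order.TTheory GRing.Theory Num.Theory.
Import numFieldNormedType.Exports.
Local Open Scope classical_set_scope.
Local Open Scope ring_scope.

(** Write [k = 1 / (1 + tau^2 lambda^2)] for the shrinkage coefficient of a
coordinate and [u = y^2 / (2 sigma^2)].  Given [lambda] the model is conjugate:
the posterior of [theta_i] is normal with mean [(1 - k) y] and variance
[sigma^2 (1 - k)], and [lambda] has marginal likelihood proportional to
[sqrt k * exp (- u k)].  The posterior factorises over the coordinates
(integral_horseshoe_posterior), and a variance is at most the mean squared
distance to any point [a], so each posterior variance is at most the ratio of
two one-dimensional integrals over the half-Cauchy law
(posterior_variance_le), whose denominator is
[D = E (sqrt k * exp (- u k))].  The choice of [a] yields three bounds.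

For [a = y] the numerator contains [E (u k^2 sqrt k exp (- u k))].  Where
[u k <= 2 log (1/tau)] the factor [u k^2] is at most [2 log (1/tau)]; elsewhere
[u k^2 exp (- u k)] is at most [16 tau / u], and [tau / u] is the order of the
lower bound on [D] coming from [lambda ~ sqrt u / tau].  Hence the variance is
[O(log (1/tau))] whatever [y] is, which settles the coordinates with a nonzero
mean.

For [a = 0] the numerator is at most a constant times
[E ((1 + u) (1 - k) sqrt k exp (- u k))], and this is [O(tau)] because its
integrand is dominated by [tau] times the derivative of
[exp (- u k) + atan (tau lambda)] in [lambda]; the gain of the factor [1 + u]
over the trivial estimate is what produces the exponent 1/2 of the logarithm.
As [D >= exp (- u) / 8], the variance is [O(tau exp u)], and trivially
[O(1 + u)].  Use the first bound for [u <= log (1/tau)] and the second one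
beyond.  Under a zero mean the density of [y] is proportional to [exp (- u)]:
the first range contributes [tau] times its length, of order
[sqrt (log (1/tau))], and the Gaussian tail contributes the same order
(integral_null_variance_bound).

Summing over the coordinates, at most [p_n] of them with a nonzero mean, gives
the theorem once [tau <= 1/e]. *)

(** * Integration and variance *)

Lemma le_of_eq d (T : porderType d) (x y : T) : x = y -> (x <= y)%O.
Proof. by move->. Qed.

Section integration.
Context d (T : measurableType d) (R : realType).
Local Open Scope ereal_scope.

(** The integral of a nonnegative function is a supremum over the simple functions
below it, so monotonicity holds without measurability.  This avoids proving that
a posterior variance is a measurable function of the data. *)
Lemma le_integral_of_le (mu : {measure set T -> \bar R}) (f g : T -> \bar R) :
  (forall x, 0 <= f x) -> (forall x, f x <= g x) ->
  \int[mu]_x f x <= \int[mu]_x g x.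
Proof.
move=> f0 fg.
have g0 x : 0 <= g x by exact: le_trans (f0 x) (fg x).
rewrite !ge0_integralE//; apply: le_ereal_sup => /= _ [h /= hf <-].
exists h => //= x; move: (hf x); rewrite !patchE mem_setT => /le_trans; exact.
Qed.

(** The mean minimises the mean squared distance.  The finiteness of the second
moment makes the integral that defines the mean converge. *)
Lemma variance_le_sqr_dist (P : probability T R) (X : T -> R) (a : R) :
  measurable_fun setT X -> \int[P]_x ((X x - a) ^+ 2)%:E < +oo ->
  'V_P[X] <= \int[P]_x ((X x - a) ^+ 2)%:E.
Proof.
move=> mX fin.
have XaL : (X \- cst a)%R \in Lfun P 2%:E.
  rewrite inE; apply/andP; split; rewrite inE/=.
    exact: measurable_funB.
  rewrite /finite_norm unlock /Lnorm poweR_lty//.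
  apply: le_lt_trans fin; apply: le_integral_of_le => x.
    exact: poweR_ge0.
  by rewrite /= lee_fin -(ger0_norm (sqr_ge0 (X x - a)%R)) normrX powR_mulrn.
have XL : X \in Lfun P 2%:E.
  have -> : X = ((X \- cst a) \+ cst a)%R by apply/funext => x /=; rewrite subrK.
  by rewrite rpredD ?lee1n//= => _; rewrite Lfun_cst.
rewrite -(varianceB_cst_r a XL) varianceE//.
rewrite [leLHS](_ : _ =
  \int[P]_x ((X x - a) ^+ 2)%:E - 'E_P[X \- cst a] ^+ 2); last first.
  by congr (_ - _); rewrite unlock.
by rewrite geeDl// oppe_le0 sqre_ge0.
Qed.

End integration.

(** * Product measures on tuples *)

Section tuple_prod.
Context d (T : measurableType d) (R : realType).
Local Open Scope ereal_scope.

(** Tonelli, by induction on the number of coordinates: under independence, the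
integral of a product of functions of the coordinates factorises. *)
Lemma integral_tuple_prob_prod n (P : 'I_n -> probability T R)
    (h : 'I_n -> T -> \bar R) :
  (forall i x, 0 <= h i x) -> (forall i, measurable_fun setT (h i)) ->
  \int[tuple_prob P]_t (\prod_(i < n) h i (tnth t i)) =
  \prod_(i < n) \int[P i]_x h i x.
Proof.
elim: n P h => [|n IH] P h h0 mh.
  rewrite big_ord0 /=.
  under eq_integral do rewrite big_ord0.
  by rewrite integral_dirac// mule1 diracT.
have mprod m (k : 'I_m -> T -> \bar R) : (forall i, measurable_fun setT (k i)) ->
    measurable_fun setT (fun t : m.-tuple T => \prod_(i < m) k i (tnth t i)).
  move=> mk; elim: (index_enum _) => [|i s IHs].
    rewrite (_ : (fun=> _) = cst 1)//.
    by apply/funext => t; rewrite big_nil.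
  rewrite (_ : (fun=> _) = (fun t : m.-tuple T => k i (tnth t i)) \*
    (fun t => \prod_(j <- s) k j (tnth t j))); last first.
    by apply/funext => t; rewrite big_cons.
  apply: emeasurable_funM => //.
  exact: (measurableT_comp (mk i) (measurable_tnth i)).
have prod0 m (k : 'I_m -> T -> \bar R) (t : m.-tuple T) : (forall i x, 0 <= k i x) ->
    0 <= \prod_(i < m) k i (tnth t i).
  by move=> k0; elim/big_ind : _ => // x y; exact: mule_ge0.
rewrite [LHS]/= ge0_integral_distribution; last 2 first.
- exact: mprod.
- by move=> t; exact: prod0.
set P' := (fun i => P (lift ord0 i)).
pose h' i := h (lift ord0 i).
transitivity (\int[prod_prob (P ord0) (tuple_prob P')]_z
    (h ord0 z.1 * \prod_(i < n) h' i (tnth z.2 i))).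
  apply: eq_integral => z _; rewrite /= big_ord_recl; congr (_ * _).
  by apply: eq_bigr => i _; rewrite tnthS.
have mF : measurable_fun setT (fun t : n.-tuple T => \prod_(i < n) h' i (tnth t i)).
  by apply: mprod => i; exact: mh.
have F0 t : 0 <= \prod_(i < n) h' i (tnth t i) by apply: prod0 => i x; exact: h0.
rewrite /prod_prob fubini_tonelli1; last 2 first.
- apply: emeasurable_funM; first exact: (measurableT_comp (mh ord0)).
  exact: (measurableT_comp mF).
- by move=> z; apply: mule_ge0.
rewrite big_ord_recl -(IH P' h')//; last 2 first.
- by move=> i x; exact: h0.
- by move=> i; exact: mh.
rewrite muleC -ge0_integralZl//.
- apply: eq_integral => x _; rewrite /fubini_F /= ge0_integralZl// 1?muleC//.
- exact: integral_ge0.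
Qed.

Lemma integral_tuple_prob_tnth n (P : 'I_n -> probability T R) (i : 'I_n)
    (f : T -> \bar R) : (forall x, 0 <= f x) -> measurable_fun setT f ->
  \int[tuple_prob P]_t f (tnth t i) = \int[P i]_x f x.
Proof.
move=> f0 mf; pose h j := if j == i then f else cst 1.
have h0 j x : 0 <= h j x by rewrite /h; case: ifP.
have mh j : measurable_fun setT (h j) by rewrite /h; case: ifP.
have := integral_tuple_prob_prod P h0 mh.
under eq_integral => t _.
  rewrite (bigD1 i)//= /h eqxx big1 ?mule1; last by move=> j /negbTE ->.
  over.
move=> ->; rewrite (bigD1 i)//= /h eqxx big1 ?mule1// => j /negbTE ->.
by rewrite integral_cst// mul1e; exact: probability_setT.
Qed.

End tuple_prod.

(** * Integrals against the horseshoe prior and posterior *)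

Section horseshoe_integrals.
Variable R : realType.
Local Notation mu := (@lebesgue_measure R).
Local Notation bR := (measurableTypeR R).
Local Open Scope ereal_scope.

Lemma integral_half_cauchy (f : bR -> \bar R) :
  measurable_fun setT f -> (forall x, 0 <= f x) ->
  \int[half_cauchy R]_l f l = \int[mu]_l (f l * (half_cauchy_pdf l)%:E).
Proof.
move=> mf f0; apply: (@ge0_integral_density _ _ _ _ mu (@half_cauchy_pdf R)) => //.
- exact: half_cauchy_pdf_ge0.
- exact: measurable_half_cauchy_pdf.
Qed.

(** The pair (lambda, theta) has a normal density with respect to the product of the
half-Cauchy law and the Lebesgue measure, so that Tonelli applies. *)
Lemma integral_horseshoe_pair (s t : R) (h : bR * bR -> \bar R) :
  measurable_fun setT h -> (forall z, 0 <= h z) ->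
  \int[horseshoe_pair s t]_z h z =
  \int[mu]_l ((\int[mu]_x (h (l, x) * (normal_pdf 0 (s * t * l) x)%:E)) *
              (half_cauchy_pdf l)%:E).
Proof.
move=> mh h0.
pose g (z : bR * bR) : R := normal_pdf 0 (s * t * z.1) z.2.
have g0 z : (0 <= g z)%R by exact: normal_pdf_ge0.
have mg : measurable_fun setT g.
  by apply: measurable_normal_pdf3 => //; exact: measurable_funM.
have mgE : measurable_fun setT (EFin \o g) by exact/measurable_EFinP.
rewrite (@ge0_integral_density _ _ _ (horseshoe_pair s t) (half_cauchy R \x mu) g)//.
  have mhg : measurable_fun setT (fun z => h z * (g z)%:E).
    exact: emeasurable_funM.
  rewrite fubini_tonelli1//=; last by move=> z; rewrite mule_ge0// lee_fin.
  rewrite integral_half_cauchy//.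
  - apply: measurable_fun_fubini_tonelli_F => // z.
    by rewrite mule_ge0// lee_fin.
  - move=> l; rewrite /fubini_F; apply: integral_ge0 => x _.
    by rewrite mule_ge0// lee_fin.
move=> A mA; rewrite [RHS]integral_mkcond.
rewrite fubini_tonelli1//=; last 2 first.
- by apply/(measurable_restrictT _ mA)/measurable_funTS.
- by apply: erestrict_ge0 => z _; rewrite lee_fin.
rewrite /horseshoe_pair; apply: eq_integral => l _.
rewrite /gaussian /normal_prob /= /fubini_F [LHS]integral_mkcond.
apply: eq_integral => x _; rewrite !patchE /g mem_xsection.
by case: ifPn.
Qed.

(** For [f = 1] this is the marginal density at [y] of one observation; the
posterior mean of [f theta] is the quotient of the two values. *)
Definition evidence_integral (s t y : R) (f : R -> R) : \bar R :=
  \int[horseshoe_pair s t]_z (f z.2 * normal_pdf z.2 s y)%:E.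

(** Bayes' formula for one coordinate: the likelihood and the prior are products, so
the factors of the other coordinates cancel between the numerator and the
normalising constant.  It is stated as a product because the quotient of two
extended reals would need a finiteness proof. *)
Lemma integral_horseshoe_posterior n (s t : R) (y : n.-tuple bR) (i : 'I_n)
    (f : R -> R) : s != 0%R -> (forall x, 0 <= f x)%R ->
    measurable_fun setT f ->
  evidence_integral s t (tnth y i) (fun=> 1%R) *
  \int[horseshoe_posterior s t y]_theta (f (tnth theta i))%:E =
  evidence_integral s t (tnth y i) f.
Proof.
move=> s0 f0 mf.
pose Z := unnormalized_posterior s (@horseshoe_prior R n s t) y setT.
have Z0 : 0 < Z := evidence_gt0 _ _ s0.
have Zoo : Z < +oo := evidence_lty _ _ s0.
have mlik : measurable_fun setT (likelihood s y).
  exact: (measurableT_comp (@measurable_likelihood R n s) (pair1_measurable y)).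
have mpdf (j : 'I_n) : measurable_fun setT
    (fun z : bR * bR => normal_pdf z.2 s (tnth y j)).
  exact: (@measurable_normal_pdf3 _ _ _ snd (cst s) (cst (tnth y j))).
have mft : measurable_fun setT (fun theta : n.-tuple bR => f (tnth theta i)).
  exact: (measurableT_comp mf (measurable_tnth i)).
(* the likelihood and the prior factorise over the coordinates *)
have prodE (g : R -> R) : (forall x, 0 <= g x)%R -> measurable_fun setT g ->
    \int[@horseshoe_prior R n s t]_theta
      (g (tnth theta i) * likelihood s y theta)%:E =
    evidence_integral s t (tnth y i) g *
      \prod_(j < n | j != i) evidence_integral s t (tnth y j) (fun=> 1%R).
  move=> g0 mg.
  have mgt : measurable_fun setT (fun theta : n.-tuple bR => g (tnth theta i)).
    exact: (measurableT_comp mg (measurable_tnth i)).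
  rewrite /horseshoe_prior ge0_integral_distribution; last 2 first.
  - by apply/measurable_EFinP; exact: measurable_funM.
  - by move=> theta; rewrite lee_fin mulr_ge0 ?likelihood_ge0.
  pose h (j : 'I_n) (z : bR * bR) : \bar R :=
    ((if j == i then g z.2 else 1) * normal_pdf z.2 s (tnth y j))%:E.
  transitivity (\int[tuple_prob (fun=> horseshoe_pair s t)]_z
      \prod_(j < n) h j (tnth z j)).
    apply: eq_integral => z _ /=.
    rewrite /likelihood tnth_mktuple prodEFin (bigD1 i)//= [in RHS](bigD1 i)//=.
    rewrite /h eqxx mulrA; congr (_ * _)%:E; first by rewrite tnth_mktuple.
    by apply: eq_bigr => j /negbTE ->; rewrite tnth_mktuple mul1r.
  rewrite (integral_tuple_prob_prod (fun=> horseshoe_pair s t)).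
  - rewrite (bigD1 i)//= /h eqxx; congr (_ * _).
    by apply: eq_bigr => j /negbTE ->.
  - move=> j z; rewrite lee_fin mulr_ge0 ?normal_pdf_ge0//.
    by case: ifP.
  - move=> j; apply/measurable_EFinP/measurable_funM => //.
    by case: (j == i) => //; exact: (measurableT_comp mg).
have ZE : Z = evidence_integral s t (tnth y i) (fun=> 1%R) *
      \prod_(j < n | j != i) evidence_integral s t (tnth y j) (fun=> 1%R).
  rewrite -[RHS](prodE (fun=> 1%R) (fun=> ler01) (measurable_cst _)).
  rewrite /Z /unnormalized_posterior.
  by apply: eq_integral => theta _; rewrite mul1r.
have fZ : (0 < fine Z)%R by rewrite fine_gt0// Z0.
have ZV : Z * (fine Z)^-1%:E = 1.
  rewrite -[X in X * _]fineK ?ge0_fin_numE ?ltW//.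
  by rewrite -EFinM divff// gt_eqF.
rewrite (@ge0_integral_density _ _ _ _ (@horseshoe_prior R n s t)
    (fun theta => likelihood s y theta / fine Z)%R); last 5 first.
- by move=> theta; rewrite divr_ge0 ?likelihood_ge0// ltW.
- exact: measurable_funM.
- move=> A mA.
  transitivity (unnormalized_posterior s (@horseshoe_prior R n s t) y A *
                (fine Z)^-1%:E); first exact: posteriorE.
  rewrite muleC.
  rewrite -ge0_integralZl//.
  + by apply: eq_integral => x _; rewrite -EFinM mulrC.
  + exact/measurable_EFinP/measurable_funTS.
  + by move=> theta _; rewrite lee_fin likelihood_ge0.
  + by rewrite lee_fin invr_ge0 ltW.
- exact/measurable_EFinP.
- by move=> theta; rewrite lee_fin.
under eq_integral do rewrite -EFinM mulrA mulrC EFinM.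
rewrite ge0_integralZl//; last 3 first.
- exact/measurable_EFinP/measurable_funM.
- by move=> theta _; rewrite lee_fin mulr_ge0 ?likelihood_ge0.
- by rewrite lee_fin invr_ge0 ltW.
rewrite prodE// muleCA (muleCA (evidence_integral _ _ _ _)) -ZE.
by rewrite muleCA (muleC _ Z) ZV mule1.
Qed.

End horseshoe_integrals.

(** * Conjugacy of the normal model *)

Section gaussian.
Variable R : realType.
Local Notation mu := (@lebesgue_measure R).
Implicit Types s t u x y a b m v : R.

(** The shrinkage coefficient of the scale [t = tau lambda]: the posterior mean given
[lambda] is [(1 - shrinkage t) y]. *)
Definition shrinkage t : R := (1 + t ^+ 2)^-1.

Lemma shrinkage_gt0 t : 0 < shrinkage t.
Proof. by rewrite invr_gt0 ltr_wpDr ?sqr_ge0. Qed.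

Lemma shrinkage_le1 t : shrinkage t <= 1.
Proof. by rewrite invf_le1 ?lerDl ?sqr_ge0// ltr_wpDr ?sqr_ge0. Qed.

Lemma shrinkage_onem t : 1 - shrinkage t = t ^+ 2 * shrinkage t.
Proof.
have h : 1 + t ^+ 2 != 0 by rewrite gt_eqF// ltr_wpDr ?sqr_ge0.
by rewrite /shrinkage; field.
Qed.

(** Marginal density of [y] given [lambda], up to the factor normal_peak, in terms of
[u = y^2 / (2 s^2)]: a centred normal density of variance [s^2 (1 + t^2)]. *)
Definition shrinkage_weight u t : R :=
  Num.sqrt (shrinkage t) * expR (- (u * shrinkage t)).

Lemma shrinkage_weight_ge0 u t : 0 <= shrinkage_weight u t.
Proof. by rewrite mulr_ge0 ?sqrtr_ge0 ?expR_ge0. Qed.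

Lemma normal_peakE s : 0 < s -> normal_peak s = (s * Num.sqrt (pi *+ 2))^-1.
Proof.
move=> s0; rewrite /normal_peak -mulrnAr sqrtrM ?sqr_ge0// sqrtr_sqr.
by rewrite gtr0_norm.
Qed.

(** Completing the square: the joint density of [theta] and [y] given the scale [b] is
the marginal density of [y] times the posterior density of [theta]. *)
Lemma normal_pdf_conjugate s b y x : 0 < s -> 0 < b ->
  normal_pdf x s y * normal_pdf 0 (s * b) x =
  normal_peak s * shrinkage_weight (y ^+ 2 / (s ^+ 2 *+ 2)) b *
  normal_pdf ((1 - shrinkage b) * y) (s * b * Num.sqrt (shrinkage b)) x.
Proof.
move=> s0 b0.
have k0 := shrinkage_gt0 b.
have sk0 : 0 < Num.sqrt (shrinkage b) by rewrite sqrtr_gt0.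
have kE : Num.sqrt (shrinkage b) ^+ 2 = shrinkage b by rewrite sqr_sqrtr// ltW.
have sb0 : 0 < s * b by rewrite mulr_gt0.
have sbk0 : 0 < s * b * Num.sqrt (shrinkage b) by rewrite mulr_gt0.
rewrite !normal_pdfE ?gt_eqF// /normal_fun !normal_peakE//.
rewrite /shrinkage_weight.
set r := Num.sqrt (pi *+ 2).
have r0 : 0 < r by rewrite sqrtr_gt0 mulrn_wgt0// pi_gt0.
set k := shrinkage b in kE k0 sk0 sbk0 *; set q := Num.sqrt k in kE sk0 sbk0 *.
rewrite mulrACA -expRD.
transitivity ((s * r)^-1 * (s * b * r)^-1 *
  expR (- (y ^+ 2 / (s ^+ 2 *+ 2) * k) +
        - (x - (1 - k) * y) ^+ 2 / ((s * b * q) ^+ 2 *+ 2))).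
  congr (_ * expR _).
  rewrite !exprMn kE /k /shrinkage.
  have h : 1 + b ^+ 2 != 0 by rewrite gt_eqF// ltr_wpDr ?sqr_ge0.
  by field; rewrite ?h !gt_eqF.
rewrite expRD.
set E1 := expR _; set E2 := expR _.
by field; rewrite !gt_eqF.
Qed.

(** With [z = (x - m)^2 / (4 v^2)], the inequality [z <= exp z] absorbs the square into
a normal density of twice the variance.  This replaces the exact second moment
[v^2 + (m - a)^2] at the price of constants: 12 is an upper bound on [8 sqrt 2]. *)
Lemma sqr_dist_normal_pdf_le m v a x : 0 < v ->
  (x - a) ^+ 2 * normal_pdf m v x <=
  12 * v ^+ 2 * normal_pdf m (Num.sqrt 2 * v) x +
  2 * (m - a) ^+ 2 * normal_pdf m v x.
Proof.
move=> v0.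
have s2 : 0 < Num.sqrt 2 :> R by rewrite sqrtr_gt0.
have s2E : Num.sqrt 2 ^+ 2 = 2 :> R by rewrite sqr_sqrtr.
have s2v : 0 < Num.sqrt 2 * v by rewrite mulr_gt0.
have p0 := normal_pdf_ge0 m v x.
suff h : 2 * (x - m) ^+ 2 * normal_pdf m v x <=
         12 * v ^+ 2 * normal_pdf m (Num.sqrt 2 * v) x.
  apply: le_trans (lerD h (lexx _)); rewrite -mulrDl ler_wpM2r//.
  by have := sqr_ge0 (x - m - (m - a)); nra.
rewrite !normal_pdfE ?gt_eqF// /normal_fun !normal_peakE//.
set r := Num.sqrt (pi *+ 2).
have r0 : 0 < r by rewrite sqrtr_gt0 mulrn_wgt0// pi_gt0.
set w := (x - m) ^+ 2.
rewrite exprMn s2E.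
set e := expR (- w / (2 * v ^+ 2 *+ 2)).
have -> : expR (- w / (v ^+ 2 *+ 2)) = e * e.
  by rewrite /e -expRD; congr expR; field; rewrite gt_eqF.
(* half of the Gaussian decay absorbs the square *)
have we : w * e <= 4 * v ^+ 2.
  rewrite /e mulNr expRN ler_pdivrMr ?expR_gt0//.
  rewrite mulrC -ler_pdivrMr ?mulr_gt0 ?exprn_gt0//.
  apply: (@le_trans _ _ (1 + w / (2 * v ^+ 2 *+ 2))); last exact: expR_ge1Dx.
  rewrite (_ : w / (2 * v ^+ 2 *+ 2) = w / (4 * v ^+ 2)) ?lerDr//.
  by field; rewrite gt_eqF.
have e0 : 0 < e := expR_gt0 _.
rewrite (_ : 2 * w * _ =
  (2 * Num.sqrt 2) * (Num.sqrt 2 * v * r)^-1 * e * (w * e)); last first.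
  by field; rewrite !gt_eqF.
rewrite (_ : 12 * _ * _ = 3 * (Num.sqrt 2 * v * r)^-1 * e * (4 * v ^+ 2)); last first.
  by field; rewrite !gt_eqF.
have sv : 0 < (Num.sqrt 2 * v * r)^-1 by rewrite invr_gt0 mulr_gt0.
have w0 : 0 <= w by exact: sqr_ge0.
have s23 : 2 * Num.sqrt 2 <= 3 :> R by nra.
apply: ler_pM => //.
- by rewrite !mulr_ge0// ltW.
- by rewrite mulr_ge0// ltW.
- by rewrite ler_wpM2r ?(ltW e0)// ler_wpM2r ?(ltW sv).
Qed.

Local Open Scope ereal_scope.

Lemma integral_sqr_dist_normal_le m v a : (0 < v)%R ->
  \int[mu]_x ((x - a) ^+ 2 * normal_pdf m v x)%:E <=
  (12 * v ^+ 2 + 2 * (m - a) ^+ 2)%:E.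
Proof.
move=> v0.
have s2v : (0 < Num.sqrt 2 * v)%R by rewrite mulr_gt0// sqrtr_gt0.
apply: (@le_trans _ _ (\int[mu]_x (
   (12 * v ^+ 2)%:E * (normal_pdf m (Num.sqrt 2 * v) x)%:E +
   (2 * (m - a) ^+ 2)%:E * (normal_pdf m v x)%:E))).
  apply: le_integral_of_le => x.
    by rewrite lee_fin mulr_ge0 ?sqr_ge0 ?normal_pdf_ge0.
  by rewrite -!EFinM -EFinD lee_fin sqr_dist_normal_pdf_le.
have mn w : measurable_fun setT (fun x => (normal_pdf m w x)%:E).
  by apply/measurable_EFinP; exact: measurable_normal_pdf.
have n0 w (x : measurableTypeR R) : setT x -> 0 <= (normal_pdf m w x)%:E.
  by rewrite lee_fin normal_pdf_ge0.
have c0 : (0 <= 12 * v ^+ 2)%R by rewrite mulr_ge0 ?sqr_ge0.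
have d0 : (0 <= 2 * (m - a) ^+ 2)%R by rewrite mulr_ge0 ?sqr_ge0.
rewrite ge0_integralD//=; last 4 first.
- by move=> x _; rewrite -EFinM lee_fin mulr_ge0 ?normal_pdf_ge0.
- exact: measurable_funeM (mn _).
- by move=> x _; rewrite -EFinM lee_fin mulr_ge0 ?normal_pdf_ge0.
- exact: measurable_funeM (mn _).
rewrite !ge0_integralZl ?lee_fin//; [|exact: mn|exact: n0|exact: mn|exact: n0].
rewrite EFinD; apply: leeD; rewrite -[leRHS]mule1.
  by apply: le_of_eq; congr (_ * _); exact: integral_normal_pdf.
by apply: le_of_eq; congr (_ * _); exact: integral_normal_pdf.
Qed.

End gaussian.

(** * Reduction to integrals over the half-Cauchy law *)

Section evidence.
Variable R : realType.
Local Notation mu := (@lebesgue_measure R).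
Local Open Scope ereal_scope.

(** The half-Cauchy mean of [F k] weighted by the marginal likelihood, [k] being the
shrinkage coefficient at the scale [t l]. *)
Definition shrinkage_integral (u t : R) (F : R -> R) : \bar R :=
  \int[mu]_l (F (shrinkage (t * l)) * shrinkage_weight u (t * l) *
              half_cauchy_pdf l)%:E.

Lemma measurable_shrinkage (t : R) :
  measurable_fun setT (fun l : R => shrinkage (t * l)).
Proof.
apply: measurable_invr_ge0 => [l|]; first by rewrite addr_ge0 ?sqr_ge0.
apply: measurable_funD => //; apply: measurable_funX.
exact: measurable_funM.
Qed.

Lemma measurable_shrinkage_weight (u t : R) :
  measurable_fun setT (fun l : R => shrinkage_weight u (t * l)).
Proof.
have mk := measurable_shrinkage t.
apply: measurable_funM.
  apply: (measurableT_comp _ mk).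
  by apply: continuous_measurable_fun; exact: sqrt_continuous.
apply: measurableT_comp => //; apply: measurableT_comp => //.
exact: measurable_funM.
Qed.

Section fix_params.
Variables (s t y : R).
Hypotheses (s0 : (0 < s)%R) (t0 : (0 < t)%R).
Let u := (y ^+ 2 / (s ^+ 2 *+ 2))%R.

(** The half-Cauchy density vanishes for [l <= 0], where the scale degenerates and the
conjugacy formula fails. *)
Lemma evidence_integralE (f : R -> R) : measurable_fun setT f ->
  (forall x, 0 <= f x)%R ->
  evidence_integral s t y f =
  \int[mu]_l ((normal_peak s * shrinkage_weight u (t * l) * half_cauchy_pdf l)%:E *
     \int[mu]_x (f x * normal_pdf ((1 - shrinkage (t * l)) * y)
       (s * (t * l) * Num.sqrt (shrinkage (t * l))) x)%:E).
Proof.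
move=> mf f0; rewrite /evidence_integral integral_horseshoe_pair; last 2 first.
- apply/measurable_EFinP/measurable_funM; first exact: (measurableT_comp mf).
  exact: (@measurable_normal_pdf3 _ _ _ snd (cst s) (cst y)).
- by move=> z; rewrite lee_fin mulr_ge0 ?normal_pdf_ge0.
apply: eq_integral => l _.
have [l0|l0] := ltP 0%R l; last first.
  by rewrite /half_cauchy_pdf ltNge l0/= mulr0 mule0 mul0e.
have b0 : (0 < t * l)%R by rewrite mulr_gt0.
under eq_integral => x _.
  rewrite -EFinM -[(s * t * l)%R]mulrA -mulrA normal_pdf_conjugate// mulrCA EFinM.
  over.
have pk0 : (0 <= normal_peak s * shrinkage_weight u (t * l))%R.
  by rewrite mulr_ge0 ?normal_peak_ge0 ?shrinkage_weight_ge0.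
rewrite ge0_integralZl//; last 2 first.
- apply/measurable_EFinP/measurable_funM => //; exact: measurable_normal_pdf.
- by move=> x _; rewrite lee_fin mulr_ge0 ?normal_pdf_ge0.
by rewrite muleAC EFinM.
Qed.

Lemma evidence_integral1 : evidence_integral s t y (fun=> 1%R) =
  (normal_peak s)%:E * shrinkage_integral u t (fun=> 1%R).
Proof.
rewrite evidence_integralE// /shrinkage_integral -ge0_integralZl//; last 3 first.
- apply/measurable_EFinP/measurable_funM; last exact: measurable_half_cauchy_pdf.
  by apply: measurable_funM => //; exact: measurable_shrinkage_weight.
- move=> l _; rewrite lee_fin !mulr_ge0 ?half_cauchy_pdf_ge0//.
- by rewrite lee_fin normal_peak_ge0.
apply: eq_integral => l _; rewrite mul1r -EFinM mulrA.
have [l0|l0] := ltP 0%R l; last first.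
  by rewrite /half_cauchy_pdf ltNge l0/= !mulr0 mul0e.
under eq_integral do rewrite mul1r.
rewrite -[RHS]mule1; congr (_ * _); first by congr EFin; ring.
exact: integral_normal_pdf.
Qed.

(** Given the scale, [theta] is normal with mean [(1 - k) y] and variance [s^2 (1 - k)];
integrate its second moment about [a] over the scale. *)
Lemma evidence_integral_sqr_dist (a : R) :
  evidence_integral s t y (fun x => (x - a) ^+ 2)%R <=
  (normal_peak s)%:E * shrinkage_integral u t
    (fun k => 12 * s ^+ 2 * (1 - k) + 2 * ((1 - k) * y - a) ^+ 2)%R.
Proof.
rewrite evidence_integralE; last 2 first.
- by apply: measurable_funX; exact: measurable_funB.
- by move=> x; exact: sqr_ge0.
have mk := measurable_shrinkage t.
have F0 l : (0 <= 12 * s ^+ 2 * (1 - shrinkage (t * l)) +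
    2 * ((1 - shrinkage (t * l)) * y - a) ^+ 2)%R.
  apply: addr_ge0; apply: mulr_ge0; rewrite ?subr_ge0 ?shrinkage_le1 ?sqr_ge0//.
  by rewrite mulr_ge0 ?sqr_ge0.
rewrite /shrinkage_integral -ge0_integralZl//; last 3 first.
- apply/measurable_EFinP/measurable_funM; last exact: measurable_half_cauchy_pdf.
  apply: measurable_funM; last exact: measurable_shrinkage_weight.
  apply: measurable_funD.
    by apply: measurable_funM => //; exact: measurable_funB.
  apply: measurable_funM => //; apply: measurable_funX.
  apply: measurable_funB => //; apply: measurable_funM => //.
  exact: measurable_funB.
- move=> l _; rewrite lee_fin mulr_ge0 ?half_cauchy_pdf_ge0// mulr_ge0//.
  exact: shrinkage_weight_ge0.
- by rewrite lee_fin normal_peak_ge0.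
apply: le_integral_of_le => l.
  apply: mule_ge0.
    by rewrite lee_fin !mulr_ge0 ?half_cauchy_pdf_ge0 ?normal_peak_ge0
      ?shrinkage_weight_ge0.
  by apply: integral_ge0 => x _; rewrite lee_fin mulr_ge0 ?sqr_ge0 ?normal_pdf_ge0.
have [l0|l0] := ltP 0%R l; last first.
  by rewrite /half_cauchy_pdf ltNge l0/= !mulr0 mul0e -EFinM mulr0.
have b0 : (0 < t * l)%R by rewrite mulr_gt0.
have v0 : (0 < s * (t * l) * Num.sqrt (shrinkage (t * l)))%R.
  by rewrite !mulr_gt0// sqrtr_gt0 shrinkage_gt0.
apply: le_trans (lee_wpmul2l _ (integral_sqr_dist_normal_le _ _ v0)) _.
  by rewrite lee_fin !mulr_ge0 ?half_cauchy_pdf_ge0 ?normal_peak_ge0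
    ?shrinkage_weight_ge0.
rewrite -!EFinM lee_fin shrinkage_onem !exprMn sqr_sqrtr ?(ltW (shrinkage_gt0 _))//.
by apply: le_of_eq; ring.
Qed.

End fix_params.
End evidence.

(** * Integrals on the real line *)

Section real_line.
Variable R : realType.
Local Notation mu := (@lebesgue_measure R).

Lemma le_integral_cst_itv (f : R -> R) (a b c : R) :
  measurable_fun setT f -> (forall x, 0 <= f x) -> a <= b -> 0 <= c ->
  (forall x, a < x <= b -> c <= f x) ->
  ((c * (b - a))%:E <= \int[mu]_x (f x)%:E)%E.
Proof.
move=> mf f0 ab c0 cf.
apply: (@le_trans _ _ (\int[mu]_(x in `]a, b]) (f x)%:E)%E); last first.
  apply: ge0_subset_integral => //; first exact/measurable_EFinP.
  by move=> x _; rewrite lee_fin.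
apply: (@le_trans _ _ (\int[mu]_(x in `]a, b]) (cst c%:E x))%E).
  rewrite integral_cst//= lebesgue_measure_itv/= lte_fin.
  case: ltP => ab'; first by rewrite -EFinD -EFinM.
  have -> : b = a by apply/eqP; rewrite eq_le ab ab'.
  by rewrite subrr mulr0 mule0.
apply: ge0_le_integral => //.
- by apply/measurable_EFinP; exact: measurable_funTS.
Qed.

Lemma is_derive_continuous (f : R -> R) (x df : R) :
  is_derive x 1 f df -> {for x, continuous f}.
Proof. by case=> /derivable1_diffP /differentiable_continuous. Qed.

Lemma ge0_integral_antiderivativey (g G : R -> R) (a l : R) :
  (forall x, a <= x -> 0 <= g x) -> continuous g ->
  (forall x : R, is_derive x 1 G (g x)) -> G x @[x --> +oo] --> l ->
  (\int[mu]_(x in `[a, +oo[) (g x)%:E = (l - G a)%:E)%E.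
Proof.
move=> g0 cg dG Gl; rewrite EFinB; apply: ge0_continuous_FTC2y => //.
- exact: continuous_subspaceT.
- by apply: cvg_at_right_filter; exact: is_derive_continuous (dG a).
- by move=> x _; rewrite derive1E; apply: derive_val.
Qed.

Lemma cvgy_shrinkage (t : R) : 0 < t -> shrinkage (t * x) @[x --> +oo] --> (0 : R).
Proof.
move=> t0; apply/gtr0_cvgV0.
  by near=> x; rewrite ltr_wpDr ?sqr_ge0.
apply/cvgryPge => A; near=> x.
have x1 : 1 <= x by near: x; exact: nbhs_pinfty_ge.
have xA : A / t ^+ 2 <= x by near: x; apply: nbhs_pinfty_ge; exact: num_real.
rewrite exprMn; apply: (@le_trans _ _ (t ^+ 2 * x)).
  by rewrite mulrC -ler_pdivrMr// exprn_gt0.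
rewrite ler_wpDl// ler_wpM2l ?sqr_ge0// expr2 -[leLHS]mulr1.
by rewrite ler_wpM2l// (le_trans ler01).
Unshelve. all: by end_near. Qed.

Lemma is_derive_shrinkage (t x : R) :
  is_derive x 1 (fun x => shrinkage (t * x))
    (- (2 * t ^+ 2 * x * shrinkage (t * x) ^+ 2)).
Proof.
have h : 1 + (t * x) ^+ 2 != 0 by rewrite gt_eqF// ltr_wpDr ?sqr_ge0.
have d : is_derive x 1 (fun x => 1 + (t * x) ^+ 2) (2 * t ^+ 2 * x).
  by apply: is_derive_eq; rewrite /GRing.scale/=; ring.
have dV := @is_deriveV _ (fun x => 1 + (t * x) ^+ 2) x _ _ h d.
apply: (is_derive_eq dV).
by rewrite /GRing.scale/= /shrinkage; field.
Qed.

Lemma continuous_shrinkage (t : R) : continuous (fun x => shrinkage (t * x)).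
Proof.
by move=> x; exact: is_derive_continuous (is_derive_shrinkage t x).
Qed.

End real_line.

(** * Lower bounds on the marginal likelihood *)

Section shrinkage_integral_bounds.
Variable R : realType.
Local Notation mu := (@lebesgue_measure R).

Lemma pi_lt4 : (pi : R) < 4.
Proof. by have := pihalf_lt2 R; rewrite ltr_pdivrMr// => /lt_le_trans; apply; lra. Qed.

Lemma half_cauchy_pdf_ge (x b : R) : 0 < x <= b ->
  (2 * (1 + b ^+ 2))^-1 <= half_cauchy_pdf x.
Proof.
move=> /andP[x0 xb]; rewrite /half_cauchy_pdf x0.
have b0 : 0 < b := lt_le_trans x0 xb.
have xb2 : x ^+ 2 <= b ^+ 2 by rewrite ler_pXn2r ?nnegrE ?(ltW x0) ?(ltW b0).
have px0 : 0 < pi * (1 + x ^+ 2) by rewrite mulr_gt0 ?pi_gt0// ltr_wpDr ?sqr_ge0.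
have b20 : 0 < 2 * (1 + b ^+ 2) by rewrite mulr_gt0// ltr_wpDr ?sqr_ge0.
rewrite ler_pdivlMr// mulrC ler_pdivrMr//.
have : pi * (1 + x ^+ 2) <= 4 * (1 + x ^+ 2).
  by rewrite ler_wpM2r ?ltW ?pi_lt4// ltr_wpDr ?sqr_ge0.
by move=> h; lra.
Qed.

Lemma measurable_shrinkage_integrand (u t : R) (F : R -> R) :
  measurable_fun setT F ->
  measurable_fun setT (fun l => F (shrinkage (t * l)) * shrinkage_weight u (t * l) *
    half_cauchy_pdf l).
Proof.
move=> mF; apply: measurable_funM; last exact: measurable_half_cauchy_pdf.
apply: measurable_funM; last exact: measurable_shrinkage_weight.
exact: (measurableT_comp mF (measurable_shrinkage t)).
Qed.

Lemma shrinkage_le_sqrt (b : R) : shrinkage b <= Num.sqrt (shrinkage b).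
Proof.
have k0 := shrinkage_gt0 b; have k1 := shrinkage_le1 b.
have s0 := sqrtr_ge0 (shrinkage b).
have sE : Num.sqrt (shrinkage b) ^+ 2 = shrinkage b by rewrite sqr_sqrtr// ltW.
have s1 : Num.sqrt (shrinkage b) <= 1 by rewrite -sqrtr1 ler_wsqrtr.
by rewrite -[leLHS]sE expr2 ler_piMl.
Qed.

(** On [0 < l <= 1] the half-Cauchy density is at least 1/4 and the shrinkage
coefficient at least 1/2. *)
Lemma shrinkage_integral1_ge_expN (u t : R) : 0 <= u -> 0 < t <= 1 ->
  ((expR (- u) / 8)%:E <= shrinkage_integral u t (fun=> 1%R))%E.
Proof.
move=> u0 /andP[t0 t1].
have h : ((expR (- u) / 8 * (1 - 0))%:E <= shrinkage_integral u t (fun=> 1%R))%E.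
  apply: (@le_integral_cst_itv _
    (fun l => 1 * shrinkage_weight u (t * l) * half_cauchy_pdf l)) => //.
  - by apply: (@measurable_shrinkage_integrand u t (fun=> 1)).
  - move=> x; rewrite !mulr_ge0 ?half_cauchy_pdf_ge0//.
  - move=> x /[dup] x01 /andP[x0 x1]; rewrite mul1r.
    have hc := half_cauchy_pdf_ge x01.
    have tx0 : 0 < t * x by rewrite mulr_gt0.
    have tx1 : t * x <= 1 by rewrite mulr_ile1// ltW.
    have k : 2^-1 <= shrinkage (t * x).
      rewrite /shrinkage lef_pV2 ?posrE// ?ltr_wpDr ?sqr_ge0//.
      have : (t * x) ^+ 2 <= 1 by rewrite exprn_ile1// ltW.
      by move=> tx2; lra.
    have k1 := shrinkage_le1 (t * x).
    have w : 2^-1 * expR (- u) <= shrinkage_weight u (t * x).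
      apply: ler_pM => //; rewrite ?expR_ge0//.
        exact: le_trans k (shrinkage_le_sqrt _).
      by rewrite ler_expR lerN2 ler_piMr.
    rewrite (_ : _ / 8 = 2^-1 * expR (- u) * (2 * (1 + 1 ^+ 2))^-1); last by field.
    exact: ler_pM.
by rewrite subr0 mulr1 in h.
Qed.

(** For a large observation the relevant scales are [l ~ sqrt u / t]: on
[sqrt u / t < l <= 2 sqrt u / t] one has [k ~ 1 / u], hence a weight of order
[1 / sqrt u], a half-Cauchy density of order [t^2 / u], and the interval has
length [sqrt u / t]. *)
Lemma shrinkage_integral1_ge_inv (u t : R) : 1 <= u -> 0 < t <= 1 ->
  ((expR (-1) / 30 * (t / u))%:E <= shrinkage_integral u t (fun=> 1%R))%E.
Proof.
move=> u1 /andP[t0 t1].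
have u0 : 0 < u by lra.
pose v := Num.sqrt u.
have vE : u = v ^+ 2 by rewrite /v sqr_sqrtr// ltW.
have v1 : 1 <= v by rewrite -sqrtr1 ler_wsqrtr.
have v0 : 0 < v by lra.
(* the product of the lower bounds on the three factors of the integrand *)
pose c := (expR (-1) / 3) * (t ^+ 2 / 10) * v ^- 3.
have c0 : 0 <= c.
  by rewrite /c !mulr_ge0 ?expR_ge0 ?sqr_ge0// ?invr_ge0 ?exprn_ge0// ltW.
have h : ((c * (2 * v / t - v / t))%:E <= shrinkage_integral u t (fun=> 1%R))%E.
  apply: (@le_integral_cst_itv _
    (fun l => 1 * shrinkage_weight u (t * l) * half_cauchy_pdf l)) => //.
  - by apply: (@measurable_shrinkage_integrand u t (fun=> 1)).
  - move=> x; rewrite !mulr_ge0 ?half_cauchy_pdf_ge0//.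
  - by rewrite ler_pM2r ?invr_gt0//; lra.
  - move=> x /andP[xl xr]; rewrite mul1r.
    have x0 : 0 < x by apply: lt_trans xl; rewrite divr_gt0.
    have hc : t ^+ 2 / 10 * v ^- 2 <= half_cauchy_pdf x.
      apply: (@le_trans _ _ (2 * (1 + (2 * v / t) ^+ 2))^-1); last first.
        by apply: half_cauchy_pdf_ge; rewrite x0.
      rewrite (_ : t ^+ 2 / 10 * v ^- 2 = (10 * v ^+ 2 / t ^+ 2)^-1); last first.
        by field; rewrite !gt_eqF.
      rewrite lef_pV2 ?posrE ?divr_gt0 ?mulr_gt0 ?exprn_gt0//; last first.
        by rewrite ltr_wpDr ?sqr_ge0.
      rewrite expr_div_n ler_pdivlMr ?exprn_gt0//.
      rewrite (_ : _ * t ^+ 2 = 2 * t ^+ 2 + 8 * v ^+ 2); last first.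
        by field; rewrite !gt_eqF.
      by nra.
    have txl : v <= t * x by rewrite mulrC -ler_pdivrMr// ltW.
    have txr : t * x <= 2 * v by rewrite mulrC -ler_pdivlMr.
    set b := t * x in txl txr *.
    have k0 := shrinkage_gt0 b.
    have uk : u * shrinkage b <= 1.
      rewrite /shrinkage ler_pdivrMr ?ltr_wpDr ?sqr_ge0// mul1r vE.
      by nra.
    have sk : (3 * v)^-1 <= Num.sqrt (shrinkage b).
      have v30 : 0 <= (3 * v)^-1 by rewrite invr_ge0 mulr_ge0// ltW.
      rewrite -(ger0_norm v30) -sqrtr_sqr ler_wsqrtr// exprVn /shrinkage.
      rewrite lef_pV2 ?posrE ?exprn_gt0 ?mulr_gt0// ?ltr_wpDr ?sqr_ge0//.
      by nra.
    rewrite /c (_ : _ * v ^- 3 =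
      ((3 * v)^-1 * expR (-1)) * (t ^+ 2 / 10 * v ^- 2)); last first.
      by field; rewrite !gt_eqF.
    apply: ler_pM => //.
    + by rewrite mulr_ge0 ?expR_ge0// invr_ge0 mulr_ge0// ltW.
    + by rewrite !divr_ge0 ?sqr_ge0.
    apply: ler_pM => //; rewrite ?expR_ge0//.
      by rewrite invr_ge0 mulr_ge0// ltW.
    by rewrite ler_expR lerN2.
apply: le_trans h; rewrite lee_fin /c vE; apply: le_of_eq.
by field; rewrite !gt_eqF.
Qed.

End shrinkage_integral_bounds.

(** * Posterior weight of weak shrinkage *)

Section shrinkage_integral_upper_bounds.
Variable R : realType.
Local Notation mu := (@lebesgue_measure R).

(** The derivative in [l] of [exp (- u k) + atan (t l)], with [k] the shrinkage
coefficient at the scale [t l]. *)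
Definition shrinkage_mass (u t l : R) : R :=
  2 * u * t ^+ 2 * l * shrinkage (t * l) ^+ 2 * expR (- (u * shrinkage (t * l)))
  + t * shrinkage (t * l).

Lemma shrinkage_mass_ge0 (u t l : R) : 0 <= u -> 0 < t -> 0 <= l ->
  0 <= shrinkage_mass u t l.
Proof.
move=> u0 /ltW t0 l0; have k0 := ltW (shrinkage_gt0 (t * l)).
by apply: addr_ge0; rewrite !mulr_ge0 ?expR_ge0 ?sqr_ge0.
Qed.

Lemma integral_shrinkage_mass (u t : R) : 0 <= u -> 0 < t ->
  (\int[mu]_(l in `[0%R, +oo[) (shrinkage_mass u t l)%:E <= 3%:E)%E.
Proof.
move=> u0 t0.
pose G (l : R) := expR (- (u * shrinkage (t * l))) + atan (t * l).
have dG (l : R) : is_derive l 1 G (shrinkage_mass u t l).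
  have dk := is_derive_shrinkage t l.
  have dk' : is_derive l 1 (fun l => - (u * shrinkage (t * l)))
      (u * (2 * t ^+ 2 * l * shrinkage (t * l) ^+ 2)).
    by apply: is_derive_eq; rewrite /GRing.scale/=; ring.
  have dt : is_derive l 1 (fun l => t * l) t.
    by apply: is_derive_eq; rewrite /GRing.scale/=; ring.
  have de := is_derive1_comp (is_derive_expR _) dk'.
  have da := is_derive1_comp (is_derive1_atan _) dt.
  have dea := is_deriveD de da.
  apply: (is_derive_eq dea).
  by rewrite /shrinkage_mass /shrinkage; ring.
rewrite (@ge0_integral_antiderivativey _ _ G 0 (1 + pi / 2)) //.
- rewrite lee_fin /G mulr0 atan0 addr0.
  by have := pihalf_lt2 R; have := expR_ge0 (- (u * shrinkage (0:R))) => h1 h2; lra.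
- by move=> l l0; exact: shrinkage_mass_ge0.
- move=> l; have ck := @continuous_shrinkage R t.
  apply: cvgD; last by apply: cvgM; [exact: cvg_cst|exact: ck].
  apply: cvgM; last first.
    apply: continuous_comp; last exact: continuous_expR.
    by apply: cvgN; apply: cvgM; [exact: cvg_cst|exact: ck].
  by apply: cvgM; [apply: cvgM; [exact: cvg_cst|exact: cvg_id]|apply: cvgM; exact: ck].
- apply: cvgD.
    rewrite -[X in _ --> X]expR0; apply: continuous_cvg; first exact: continuous_expR.
    rewrite -oppr0 -(mulr0 u); apply: cvgN; apply: cvgM; first exact: cvg_cst.
    exact: cvgy_shrinkage.
  apply: (cvg_comp _ _ _ (@cvgy_atan R)).
  by apply: gt0_cvgMry => //.
Qed.

(** The pointwise form of the domination by shrinkage_mass.  For [b <= 1] one has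
[k >= 1/2] and [(1 + u) exp (- u k)] is bounded; for [b >= 1] one has
[sqrt k <= 2 b k], because [k (1 + b^2) = 1]. *)
Lemma sqrt_shrinkage_exp_le (u b : R) : 0 <= u -> 0 < b ->
  Num.sqrt (shrinkage b) * ((1 + u) * expR (- (u * shrinkage b))) <=
  2 * (2 * u * b * shrinkage b * expR (- (u * shrinkage b)) + 1).
Proof.
move=> u0 b0.
set k := shrinkage b; set e := expR _.
have k0 : 0 < k := shrinkage_gt0 b.
have k1 : k <= 1 := shrinkage_le1 b.
have e0 : 0 < e := expR_gt0 _.
have kE : k * (1 + b ^+ 2) = 1 by rewrite mulVf// gt_eqF// ltr_wpDr ?sqr_ge0.
have q0 : 0 <= Num.sqrt k := sqrtr_ge0 _.
have qE : Num.sqrt k ^+ 2 = k by rewrite sqr_sqrtr// ltW.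
have q1 : Num.sqrt k <= 1 by rewrite -sqrtr1 ler_wsqrtr.
have uk0 : 0 <= u * k by rewrite mulr_ge0// ltW.
have [b1|b1] := leP b 1.
  have k2 : 2^-1 <= k.
    rewrite /k /shrinkage lef_pV2 ?posrE// ?ltr_wpDr ?sqr_ge0//.
    have : b ^+ 2 <= 1 by rewrite exprn_ile1// ltW.
    by move=> ?; lra.
  have ue : (1 + u) * e <= 2.
    rewrite /e expRN ler_pdivrMr ?expR_gt0//.
    apply: (@le_trans _ _ (2 * (1 + u * k))); first by nra.
    by rewrite ler_pM2l// expR_ge1Dx.
  have ue0 : 0 <= (1 + u) * e by rewrite mulr_ge0 ?addr_ge0// ltW.
  have h0 : 0 <= 2 * u * b * k * e by rewrite !mulr_ge0// ltW.
  apply: (@le_trans _ _ (1 * 2)); first exact: ler_pM.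
  by lra.
have e1 : e <= 1 by rewrite /e -expR0 ler_expR oppr_le0.
have qb : Num.sqrt k <= 2 * b * k.
  have h : 0 <= 2 * b * k by rewrite !mulr_ge0// ltW.
  rewrite -(ger0_norm h) -sqrtr_sqr ler_wsqrtr//.
  have -> : (2 * b * k) ^+ 2 = k * (4 * (k * b ^+ 2)) by ring.
  have : 1 <= 4 * (k * b ^+ 2) by nra.
  by move=> ?; nra.
have ue0 : 0 <= u * e by rewrite mulr_ge0// ltW.
have h1 : Num.sqrt k * (u * e) <= 2 * b * k * (u * e) by rewrite ler_wpM2r.
have h2 : Num.sqrt k * e <= 1 by rewrite mulr_ile1// ltW.
have h0 : 0 <= 2 * b * k * (u * e) by rewrite !mulr_ge0// ltW.
by nra.
Qed.

(** Weak shrinkage is rare: [1 - k = t^2 l^2 k], and [l^2] times the half-Cauchy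
density is at most 1, so the integrand is at most [2 t] times shrinkage_mass,
whose integral is at most [1 + pi / 2]. *)
Lemma shrinkage_integral_onem_le (u t : R) : 0 <= u -> 0 < t ->
  (shrinkage_integral u t (fun k => (1 + u) * (1 - k))%R <= (6 * t)%:E)%E.
Proof.
move=> u0 t0.
have mm : measurable_fun setT (shrinkage_mass u t).
  have mk := measurable_shrinkage t.
  apply: measurable_funD; last exact: measurable_funM.
  apply: measurable_funM; last first.
    apply: measurableT_comp => //; apply: measurableT_comp => //.
    exact: measurable_funM.
  by apply: measurable_funM; [exact: measurable_funM|exact: measurable_funX].
have m0 l : 0 <= l -> 0 <= shrinkage_mass u t l by exact: shrinkage_mass_ge0.
pose F l := (\1_`[0%R, +oo[ l * (2 * t * shrinkage_mass u t l))%:E.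
apply: (@le_trans _ _ (\int[mu]_l F l)%E); last first.
  rewrite (_ : (\int[mu]_l F l)%E =
     \int[mu]_(l in `[0%R, +oo[) ((2 * t)%:E * (shrinkage_mass u t l)%:E)%E)%E; last first.
    rewrite [RHS]integral_mkcond; apply: eq_integral => l _.
    by rewrite /F patchE indicE; case: ifPn; rewrite ?mul1r ?mul0r ?EFinM.
  rewrite ge0_integralZl//; last 3 first.
  - by apply/measurable_EFinP; exact: measurable_funTS.
  - by move=> l /=; rewrite in_itv/= andbT => l0; rewrite lee_fin m0.
  - by rewrite lee_fin mulr_ge0// ltW.
  rewrite (_ : 6 * t = 2 * t * 3); last by ring.
  rewrite [leRHS]EFinM; apply: lee_wpmul2l; first by rewrite lee_fin mulr_ge0 ?(ltW t0).
  exact: integral_shrinkage_mass.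
apply: le_integral_of_le => l.
  have k1 : 0 <= 1 - shrinkage (t * l) by rewrite subr_ge0 shrinkage_le1.
  rewrite lee_fin; apply: mulr_ge0; last exact: half_cauchy_pdf_ge0.
  rewrite mulr_ge0 ?shrinkage_weight_ge0// mulr_ge0//; lra.
rewrite /F lee_fin.
have [l0|l0] := ltP 0 l; last first.
  rewrite [in leLHS]/half_cauchy_pdf ltNge l0/= mulr0 indicE mem_setE in_itv/= andbT.
  by case: (leP 0 l) => l0'; rewrite ?mul0r// mul1r mulr_ge0 ?mulr_ge0 ?m0 ?(ltW t0).
rewrite indicE mem_setE in_itv/= andbT (ltW l0) mul1r.
have b0 : 0 < t * l by rewrite mulr_gt0.
have k0 := shrinkage_gt0 (t * l).
have hc : l ^+ 2 * half_cauchy_pdf l <= 1.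
  rewrite /half_cauchy_pdf l0 mulrA ler_pdivrMr ?mulr_gt0 ?pi_gt0 ?ltr_wpDr ?sqr_ge0//.
  have p2 := pi_ge2 R; have l2 := sqr_ge0 l.
  have : 2 * (1 + l ^+ 2) <= pi * (1 + l ^+ 2) by rewrite ler_wpM2r ?addr_ge0.
  by move=> ?; lra.
have key := sqrt_shrinkage_exp_le u0 b0.
rewrite shrinkage_onem /shrinkage_weight /shrinkage_mass.
set k := shrinkage (t * l) in k0 key *; set e := expR _ in key *.
have e0 : 0 <= e := expR_ge0 _.
have q0 : 0 <= Num.sqrt k := sqrtr_ge0 _.
have c0 : 0 <= t ^+ 2 * k by rewrite mulr_ge0 ?sqr_ge0 ?ltW.
have A0 : 0 <= t ^+ 2 * k * (Num.sqrt k * ((1 + u) * e)).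
  by rewrite mulr_ge0// mulr_ge0// mulr_ge0// addr_ge0.
rewrite [leLHS](_ : _ = (l ^+ 2 * half_cauchy_pdf l) *
   (t ^+ 2 * k * (Num.sqrt k * ((1 + u) * e)))); last by ring.
apply: (@le_trans _ _ (1 * (t ^+ 2 * k * (Num.sqrt k * ((1 + u) * e))))).
  by rewrite ler_wpM2r.
rewrite mul1r.
apply: le_trans (ler_wpM2l c0 key) _.
by apply: le_of_eq; ring.
Qed.

End shrinkage_integral_upper_bounds.

(** * Posterior weight of strong shrinkage *)

Section shrinkage_integral_comparison.
Variable R : realType.
Local Notation mu := (@lebesgue_measure R).
Local Open Scope ereal_scope.

Lemma le_shrinkage_integral (u t : R) (F G : R -> R) :
  (forall k, 0 < k <= 1 -> 0 <= F k <= G k)%R ->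
  shrinkage_integral u t F <= shrinkage_integral u t G.
Proof.
move=> FG; apply: le_integral_of_le => l;
  have k01 : (0 < shrinkage (t * l) <= 1)%R by rewrite shrinkage_gt0 shrinkage_le1.
  have /andP[F0 _] := FG _ k01.
  by rewrite lee_fin !mulr_ge0 ?half_cauchy_pdf_ge0 ?shrinkage_weight_ge0.
have /andP[_ FGl] := FG _ k01.
rewrite lee_fin ler_wpM2r ?half_cauchy_pdf_ge0//.
by rewrite ler_wpM2r ?shrinkage_weight_ge0.
Qed.

Lemma shrinkage_integralZ (u t c : R) (F : R -> R) : measurable_fun setT F ->
  (0 <= c)%R -> (forall k, 0 < k <= 1 -> 0 <= F k)%R ->
  shrinkage_integral u t (fun k => c * F k)%R = c%:E * shrinkage_integral u t F.
Proof.
move=> mF c0 F0; rewrite /shrinkage_integral -ge0_integralZl//.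
- by apply: eq_integral => l _; rewrite -EFinM !mulrA.
- by apply/measurable_EFinP; exact: measurable_shrinkage_integrand.
- move=> l _; rewrite lee_fin !mulr_ge0 ?half_cauchy_pdf_ge0 ?shrinkage_weight_ge0//.
  by rewrite F0// shrinkage_gt0 shrinkage_le1.
Qed.

Lemma shrinkage_integralD (u t : R) (F G : R -> R) :
  measurable_fun setT F -> measurable_fun setT G ->
  (forall k, 0 < k <= 1 -> 0 <= F k)%R -> (forall k, 0 < k <= 1 -> 0 <= G k)%R ->
  shrinkage_integral u t (fun k => F k + G k)%R =
  shrinkage_integral u t F + shrinkage_integral u t G.
Proof.
move=> mF mG F0 G0; rewrite /shrinkage_integral -ge0_integralD//.
- by apply: eq_integral => l _; rewrite -EFinD !mulrDl.
- move=> l _; rewrite lee_fin !mulr_ge0 ?half_cauchy_pdf_ge0 ?shrinkage_weight_ge0//.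
  by rewrite F0// shrinkage_gt0 shrinkage_le1.
- by apply/measurable_EFinP; exact: measurable_shrinkage_integrand.
- move=> l _; rewrite lee_fin !mulr_ge0 ?half_cauchy_pdf_ge0 ?shrinkage_weight_ge0//.
  by rewrite G0// shrinkage_gt0 shrinkage_le1.
- by apply/measurable_EFinP; exact: measurable_shrinkage_integrand.
Qed.

Lemma shrinkage_weight_le1 (u b : R) : (0 <= u)%R -> (shrinkage_weight u b <= 1)%R.
Proof.
move=> u0; rewrite /shrinkage_weight mulr_ile1 ?sqrtr_ge0 ?expR_ge0//.
  by rewrite -sqrtr1 ler_wsqrtr// shrinkage_le1.
by rewrite -expR0 ler_expR oppr_le0 mulr_ge0// ltW// shrinkage_gt0.
Qed.

Lemma shrinkage_integral1_le1 (u t : R) : (0 <= u)%R ->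
  shrinkage_integral u t (fun=> 1%R) <= 1.
Proof.
move=> u0; rewrite -(integral_half_cauchy_pdf R); apply: le_integral_of_le => l.
  by rewrite lee_fin !mulr_ge0 ?half_cauchy_pdf_ge0 ?shrinkage_weight_ge0.
by rewrite lee_fin mul1r ler_piMl ?half_cauchy_pdf_ge0 ?shrinkage_weight_le1.
Qed.

(** The 2 comes from sqr_shrinkage_exp_le; the 480 is 16, from the same lemma, times
30, from shrinkage_integral1_ge_inv, which also gives the factor [exp 1]. *)
Definition signal_constant : R := (2 + 480 * expR 1)%R.

(** Put [x = u k].  If [x <= 2 log (1/t)] then [u k^2 <= x] suffices.  Otherwise
[exp (- x / 2) <= t], while [x^2 exp (- x / 2) <= 16]. *)
Lemma sqr_shrinkage_exp_le (u t k : R) :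
  (0 < u)%R -> (0 < t <= 1)%R -> (0 < k <= 1)%R ->
  (u * k ^+ 2 * expR (- (u * k)) <=
   2 * ln (1 / t) * expR (- (u * k)) + 16 * (t / u))%R.
Proof.
move=> u0 /andP[t0 t1] /andP[k0 k1].
set x := (u * k)%R.
have x0 : (0 < x)%R by rewrite mulr_gt0.
have l0 : (0 <= ln (1 / t))%R by rewrite ln_ge0// ler_pdivlMr// mul1r.
have e0 := expR_gt0 (- x).
have tu0 : (0 < t / u)%R by rewrite divr_gt0.
have [xl|xl] := leP x (2 * ln (1 / t))%R.
  rewrite -[leLHS]addr0 lerD//; last by rewrite mulr_ge0// ltW.
  rewrite ler_wpM2r ?(ltW e0)//; apply: le_trans xl.
  by rewrite expr2 mulrA -/x ler_piMr// ltW.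
rewrite -[leLHS]add0r lerD//; first by rewrite !mulr_ge0// ltW.
rewrite (_ : u * k ^+ 2 * _ = x ^+ 2 * expR (- x) / u)%R; last first.
  by rewrite /x; field; rewrite gt_eqF.
rewrite mulrA ler_pM2r ?invr_gt0//.
have -> : expR (- x) = (expR (- (x / 2)) * expR (- (x / 4)) ^+ 2)%R.
  by rewrite expr2 -!expRD; congr expR; field.
have h1 : (expR (- (x / 2)) <= t)%R.
  rewrite -[leRHS](lnK t0)// ler_expR.
  rewrite div1r lnV in xl; last by [].
  by lra.
have h2 : (x * expR (- (x / 4)) <= 4)%R.
  rewrite expRN ler_pdivrMr ?expR_gt0//.
  have := expR_ge1Dx (x / 4); lra.
have h3 : (0 <= x * expR (- (x / 4)))%R by rewrite mulr_ge0 ?expR_ge0// ltW.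
rewrite (_ : _ * _ = (x * expR (- (x / 4))) ^+ 2 * expR (- (x / 2)))%R; last by ring.
apply: ler_pM; rewrite ?sqr_ge0 ?expR_ge0//.
by rewrite (_ : 16 = 4 ^+ 2)%R ?ler_pXn2r ?nnegrE//; ring.
Qed.

(** Integrate sqr_shrinkage_exp_le; the error term [t / u] is absorbed by the lower
bound on the marginal likelihood when [u >= 1], and for [u <= 1] the weight [u k^2] is
at most 1. *)
Lemma shrinkage_integral_sqr_le (u t : R) : (0 <= u)%R -> (0 < t <= 1)%R ->
  (1 <= ln (1 / t))%R ->
  shrinkage_integral u t (fun k => u * k ^+ 2)%R <=
  (signal_constant * ln (1 / t))%:E * shrinkage_integral u t (fun=> 1%R).
Proof.
move=> u0 t01 l1.
have /andP[t0 t1] := t01.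
set D := shrinkage_integral u t (fun=> 1%R).
have D0 : 0 <= D.
  apply: integral_ge0 => l _.
  by rewrite lee_fin mul1r mulr_ge0 ?half_cauchy_pdf_ge0 ?shrinkage_weight_ge0.
have cl1 : (1 <= signal_constant * ln (1 / t))%R.
  have := expR_gt0 (1:R); rewrite /signal_constant => e0.
  by rewrite (le_trans l1)// ler_peMl ?(le_trans ler01)//; lra.
have [u1|u1] := leP u 1%R.
  apply: (@le_trans _ _ D); last by rewrite -[leLHS]mul1e lee_wpmul2r.
  apply: le_shrinkage_integral => k /andP[k0 k1].
  rewrite mulr_ge0 ?sqr_ge0//= mulr_ile1 ?sqr_ge0//.
  by rewrite exprn_ile1// ltW.
have {}u0 : (0 < u)%R by lra.
apply: (@le_trans _ _ ((2 * ln (1 / t))%:E * D + (16 * (t / u))%:E)).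
  have l0 : (0 <= 2 * ln (1 / t))%R by lra.
  have c0 : (0 <= 16 * (t / u))%R by rewrite mulr_ge0 ?divr_ge0// ltW.
  have mW : measurable_fun setT
      (fun l : R => (1 * shrinkage_weight u (t * l) * half_cauchy_pdf l)%:E).
    by apply/measurable_EFinP; exact: (@measurable_shrinkage_integrand _ u t (fun=> 1%R)).
  have mh : measurable_fun setT (fun l : R => (half_cauchy_pdf l)%:E).
    by apply/measurable_EFinP; exact: measurable_half_cauchy_pdf.
  have W0 (l : R) : 0 <= (1 * shrinkage_weight u (t * l) * half_cauchy_pdf l)%:E.
    by rewrite lee_fin !mulr_ge0 ?half_cauchy_pdf_ge0 ?shrinkage_weight_ge0.
  rewrite -[X in _ + X]mule1 -(integral_half_cauchy_pdf R).
  rewrite /D /shrinkage_integral -!ge0_integralZl//; last first.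
    by move=> l _; rewrite lee_fin half_cauchy_pdf_ge0.
  rewrite -ge0_integralD//=; last 4 first.
  - by move=> l _; rewrite mule_ge0// lee_fin.
  - exact: measurable_funeM mW.
  - by move=> l _; rewrite mule_ge0// lee_fin ?half_cauchy_pdf_ge0.
  - exact: measurable_funeM mh.
  apply: le_integral_of_le => l.
    rewrite lee_fin; apply: mulr_ge0; last exact: half_cauchy_pdf_ge0.
    by apply: mulr_ge0; [rewrite mulr_ge0 ?sqr_ge0 ?ltW|exact: shrinkage_weight_ge0].
  rewrite -!EFinM -EFinD lee_fin.
  rewrite [leRHS](_ : _ = (2 * ln (1 / t) * shrinkage_weight u (t * l) +
    16 * (t / u)) * half_cauchy_pdf l)%R; last by ring.
  rewrite ler_wpM2r ?half_cauchy_pdf_ge0//.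
  have k0 := shrinkage_gt0 (t * l); have k1 := shrinkage_le1 (t * l).
  rewrite /shrinkage_weight; set k := shrinkage (t * l) in k0 k1 *.
  have h := sqr_shrinkage_exp_le u0 t01 (introT andP (conj k0 k1)).
  have q0 : (0 <= Num.sqrt k)%R := sqrtr_ge0 _.
  have q1 : (Num.sqrt k <= 1)%R by rewrite -sqrtr1 ler_wsqrtr.
  set e := expR _ in h *.
  have := ler_wpM2l q0 h; rewrite mulrDr => h'.
  have h2 : (Num.sqrt k * (16 * (t / u)) <= 16 * (t / u))%R by rewrite ler_piMl.
  rewrite [leLHS](_ : _ = Num.sqrt k * (u * k ^+ 2 * e))%R; last by ring.
  apply: le_trans h' _; rewrite lerD//.
  by apply: le_of_eq; ring.
have Dlow := shrinkage_integral1_ge_inv (ltW u1) t01.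
have a0 : (0 <= 2 * ln (1 / t))%R by lra.
have e0 : (0 <= 480 * expR 1 :> R)%R.
  by apply: mulr_ge0; [exact: ler0n|exact: expR_ge0].
have c0 : (0 <= 480 * expR 1 * ln (1 / t))%R.
  by apply: mulr_ge0 => //; exact: le_trans ler01 l1.
rewrite (_ : signal_constant * _ = 2 * ln (1 / t) + 480 * expR 1 * ln (1 / t))%R;
  last exact: mulrDl.
rewrite EFinD [leRHS]ge0_muleDl ?lee_fin//; apply: leeD => //.
have ec : (480 * expR 1 <= 480 * expR 1 * ln (1 / t) :> R)%R by exact: ler_peMr.
apply: (@le_trans _ _ ((480 * expR 1)%:E * D)); last first.
  by apply: lee_wpmul2r => //; rewrite lee_fin.
have e1 : (0 <= (480 * expR 1 : R)%:E) by rewrite lee_fin.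
apply: le_trans (lee_wpmul2l e1 Dlow).
rewrite -EFinM lee_fin expRN; apply: le_of_eq.
by field; rewrite !gt_eqF// expR_gt0.
Qed.

End shrinkage_integral_comparison.

(** * Bounds on the posterior variance of a coordinate *)

Section posterior_variance.
Context (R : realType) (n : nat) (s t : R).
Context (y : n.-tuple (measurableTypeR R)) (i : 'I_n).
Hypotheses (s0 : 0 < s) (t01 : 0 < t <= 1).
Let u := (tnth y i : R) ^+ 2 / (s ^+ 2 *+ 2).
Let t0 : 0 < t. Proof. by case/andP: t01. Qed.
Let u0 : 0 <= u. Proof. by rewrite divr_ge0 ?sqr_ge0// mulrn_wge0 ?sqr_ge0. Qed.
Local Open Scope ereal_scope.
Local Notation D := (shrinkage_integral u t (fun=> 1%R)).
Local Notation V := ('V_(horseshoe_posterior s t y) [fun theta => tnth theta i]).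

Let D_gt0 : 0 < D.
Proof.
apply: lt_le_trans (shrinkage_integral1_ge_expN u0 t01).
by rewrite lte_fin divr_gt0 ?expR_gt0.
Qed.

Let D_lty : D < +oo.
Proof. by apply: le_lt_trans (shrinkage_integral1_le1 _ u0) _; rewrite ltry. Qed.

(** A bound on the squared distance to [a], averaged over the scale relative to the
marginal likelihood, bounds the posterior variance.  The point [a] is [0] or the
observation in what follows. *)
Lemma posterior_variance_le (a B : R) :
  shrinkage_integral u t (fun k => 12 * s ^+ 2 * (1 - k) +
     2 * ((1 - k) * tnth y i - a) ^+ 2)%R <= B%:E * D ->
  V <= B%:E.
Proof.
move=> h.
have mf : measurable_fun setT (fun x : R => (x - a) ^+ 2)%R.
  by apply: measurable_funX; exact: measurable_funB.
have I_le : \int[horseshoe_posterior s t y]_theta ((tnth theta i - a) ^+ 2)%:E <= B%:E.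
  have f0 (x : R) : (0 <= (x - a) ^+ 2)%R by exact: sqr_ge0.
  have sn : s != 0%R by rewrite gt_eqF.
  have E := integral_horseshoe_posterior t y i sn f0 mf.
  have p0 : (0 < normal_peak s)%R by rewrite normal_peak_gt0.
  have pD0 : 0 < (normal_peak s)%:E * D by rewrite mule_gt0// lte_fin.
  have pDfin : (normal_peak s)%:E * D \is a fin_num.
    by rewrite fin_numM// ge0_fin_numE// ltW.
  rewrite -(@lee_pmul2l _ ((normal_peak s)%:E * D))//.
  rewrite -{1}evidence_integral1// E.
  apply: le_trans (evidence_integral_sqr_dist _ s0 t0 _) _.
  by rewrite -muleA (muleC D) lee_pmul2l// lte_fin.
apply: (le_trans _ I_le).
apply: (variance_le_sqr_dist
  (X := fun theta : n.-tuple (measurableTypeR R) => tnth theta i)).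
  exact: measurable_tnth.
by apply: le_lt_trans I_le _; rewrite ltry.
Qed.

Let uE : (tnth y i ^+ 2 = 2 * s ^+ 2 * u)%R.
Proof. by rewrite /u; field; rewrite gt_eqF. Qed.

(** Compare with the observation itself ([a = y]): the posterior mean given the scale
misses it by [k y], and [y^2 k^2 = 2 s^2 u k^2]. *)
Lemma posterior_variance_le_ln : (1 <= ln (1 / t))%R ->
  V <= ((12 + 4 * signal_constant R) * s ^+ 2 * ln (1 / t))%:E.
Proof.
move=> l1; apply: (@posterior_variance_le (tnth y i)).
have s20 : (0 <= s ^+ 2)%R by exact: sqr_ge0.
have F1 := shrinkage_integral_sqr_le u0 t01 l1.
apply: (@le_trans _ _ (shrinkage_integral u t
    (fun k => 12 * s ^+ 2 * 1 + 4 * s ^+ 2 * (u * k ^+ 2)))%R).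
  apply: le_shrinkage_integral => k /andP[k0 k1].
  have ok : (0 <= 1 - k)%R by rewrite subr_ge0.
  apply/andP; split; first
    by apply: addr_ge0; apply: mulr_ge0 => //; rewrite ?sqr_ge0 // mulr_ge0.
  rewrite (_ : (1 - k) * tnth y i - tnth y i = - (k * tnth y i))%R; last by ring.
  rewrite sqrrN exprMn uE lerD//.
    have sk : (0 <= s ^+ 2 * k)%R by rewrite mulr_ge0// ltW.
    by lra.
  by apply: le_of_eq; ring.
have mk : measurable_fun setT (fun k : R => u * k ^+ 2)%R.
  by apply: measurable_funM => //; exact: measurable_funX.
rewrite (@shrinkage_integralD _ _ _ (fun=> 12 * s ^+ 2 * 1)%R
  (fun k => 4 * s ^+ 2 * (u * k ^+ 2))%R)//; last 3 first.
- exact: measurable_funM.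
- by move=> k _; rewrite mulr1 mulr_ge0.
- move=> k _; apply: mulr_ge0; first by rewrite mulr_ge0.
  by rewrite mulr_ge0 // sqr_ge0.
rewrite (@shrinkage_integralZ _ _ _ _ (fun=> 1%R))//; last by rewrite mulr_ge0.
rewrite (@shrinkage_integralZ _ _ _ _ (fun k => u * k ^+ 2)%R)//; last 2 first.
- by rewrite mulr_ge0.
- by move=> k _; rewrite mulr_ge0 // sqr_ge0.
have l0 : (0 <= ln (1 / t))%R by rewrite (le_trans ler01).
have c0 : (0 <= signal_constant R)%R.
  apply: addr_ge0; first exact: ler0n.
  by apply: mulr_ge0; [exact: ler0n|exact: expR_ge0].
rewrite (_ : (12 + _) * _ * _ = 12 * s ^+ 2 * ln (1 / t) +
  4 * s ^+ 2 * (signal_constant R * ln (1 / t)))%R; last by ring.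
have a0 : (0 <= 12 * s ^+ 2 * ln (1 / t))%R by rewrite mulr_ge0 // mulr_ge0.
have b0 : (0 <= 4 * s ^+ 2 * (signal_constant R * ln (1 / t)))%R.
  by rewrite mulr_ge0 // mulr_ge0.
rewrite EFinD ge0_muleDl ?lee_fin//; apply: leeD.
  by apply: lee_wpmul2r; rewrite ?(ltW D_gt0)// lee_fin ler_peMr// mulr_ge0.
rewrite [X in _ <= X * _]EFinM -muleA.
by apply: lee_wpmul2l => //; rewrite lee_fin mulr_ge0.
Qed.

Let shrink_to_0 : shrinkage_integral u t (fun k => 12 * s ^+ 2 * (1 - k) +
     2 * ((1 - k) * tnth y i - 0) ^+ 2)%R <=
  shrinkage_integral u t (fun k => 12 * s ^+ 2 * ((1 + u) * (1 - k)))%R.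
Proof.
apply: le_shrinkage_integral => k /andP[k0 k1].
have s20 : (0 <= s ^+ 2)%R by exact: sqr_ge0.
have ok : (0 <= 1 - k)%R by rewrite subr_ge0.
apply/andP; split; first
    by apply: addr_ge0; apply: mulr_ge0 => //; rewrite ?sqr_ge0 // mulr_ge0.
rewrite subr0 exprMn uE.
have : (u * (1 - k) ^+ 2 <= u * (1 - k))%R.
  by rewrite ler_wpM2l// expr2 ler_piMl//; lra.
have uk : (0 <= u * (1 - k))%R by rewrite mulr_ge0.
move=> h.
have : (s ^+ 2 * (u * (1 - k) ^+ 2) <= s ^+ 2 * (u * (1 - k)))%R by rewrite ler_wpM2l.
have : (0 <= s ^+ 2 * (u * (1 - k)))%R by rewrite mulr_ge0.
by move=> *; lra.
Qed.

Let mF : measurable_fun setT (fun k : R => (1 + u) * (1 - k))%R.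
Proof. by apply: measurable_funM => //; exact: measurable_funB. Qed.

Let c0 : (0 <= 12 * s ^+ 2)%R. Proof. by rewrite mulr_ge0 ?sqr_ge0. Qed.

(** Compare with 0.  The posterior weight of weak shrinkage is at most [6 t] over the
marginal likelihood, which is at least [exp (- u) / 8]. *)
Lemma posterior_variance_le_expR : V <= (576 * s ^+ 2 * t * expR u)%:E.
Proof.
apply: (@posterior_variance_le 0); apply: le_trans shrink_to_0 _.
rewrite (@shrinkage_integralZ _ _ _ _ (fun k => (1 + u) * (1 - k))%R)//; last first.
  by move=> k /andP[k0 k1]; apply: mulr_ge0; [exact: addr_ge0|rewrite subr_ge0].
apply: le_trans (lee_wpmul2l _ (shrinkage_integral_onem_le u0 t0)) _.
  by rewrite lee_fin.
apply: le_trans (lee_wpmul2l _ (shrinkage_integral1_ge_expN u0 t01)); last first.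
  rewrite lee_fin; apply: mulr_ge0; last exact: expR_ge0.
  apply: mulr_ge0; last exact: ltW.
  by apply: mulr_ge0; [exact: ler0n|exact: sqr_ge0].
rewrite -!EFinM lee_fin expRN; apply: le_of_eq.
by field; rewrite gt_eqF// expR_gt0.
Qed.

(** Compare with 0, bounding [1 - k] by 1. *)
Lemma posterior_variance_le_sqr : V <= (12 * s ^+ 2 * (1 + u))%:E.
Proof.
apply: (@posterior_variance_le 0); apply: le_trans shrink_to_0 _.
rewrite -(@shrinkage_integralZ _ _ _ _ (fun=> 1%R))//; last first.
  by apply: mulr_ge0 => //; exact: addr_ge0.
apply: le_shrinkage_integral => k /andP[k0 k1].
have u1 : (0 <= 1 + u)%R by exact: addr_ge0.
have ok : (0 <= 1 - k)%R by rewrite subr_ge0.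
have c1 : (0 <= 12 * s ^+ 2 * (1 + u))%R by exact: mulr_ge0.
by rewrite mulrA mulr_ge0//= mulr1 ler_piMr//; lra.
Qed.

End posterior_variance.

(** * Expected variance under a zero mean *)

Section null_signal.
Context (R : realType) (s t : R).
Hypotheses (s0 : 0 < s) (t0 : 0 < t) (l1 : 1 <= ln (1 / t)).
Local Notation mu := (@lebesgue_measure R).
Local Notation bR := (measurableTypeR R).
Let u (y : R) := y ^+ 2 / (s ^+ 2 *+ 2).
Let ell := ln (1 / t).
Let zeta := s * Num.sqrt (2 * ell).

(** The bound of posterior_variance_le_expR as long as [t exp u <= 1], that of
posterior_variance_le_sqr beyond: the former is a multiple of the inverse of the
normal density, so its mean over the whole line is infinite. *)
Definition null_variance_bound (y : R) : R :=
  if y ^+ 2 / (s ^+ 2 *+ 2) <= ln (1 / t)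
  then 576 * s ^+ 2 * t * expR (y ^+ 2 / (s ^+ 2 *+ 2))
  else 12 * s ^+ 2 * (1 + y ^+ 2 / (s ^+ 2 *+ 2)).

Let s20 : 0 < s ^+ 2 *+ 2. Proof. by rewrite mulrn_wgt0// exprn_gt0. Qed.

Let u_ge0 y : 0 <= u y. Proof. by rewrite divr_ge0 ?sqr_ge0// ltW. Qed.

Lemma null_variance_bound_ge0 y : 0 <= null_variance_bound y.
Proof.
have c0 : 0 <= s ^+ 2 by exact: sqr_ge0.
rewrite /null_variance_bound; case: ifP => _.
  apply: mulr_ge0; last exact: expR_ge0.
  apply: mulr_ge0; last exact: ltW.
  by apply: mulr_ge0; [exact: ler0n|].
by apply: mulr_ge0; [exact: mulr_ge0|apply: addr_ge0 => //; exact: u_ge0].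
Qed.

Let measurable_u : measurable_fun setT u.
Proof. by apply: measurable_funM => //; exact: measurable_funX. Qed.

Lemma measurable_null_variance_bound : measurable_fun setT null_variance_bound.
Proof.
apply: measurable_fun_ifT.
- exact: measurable_fun_ler.
- by apply: measurable_funM => //; exact: measurableT_comp.
- by apply: measurable_funM => //; exact: measurable_funD.
Qed.

Let zeta_gt0 : 0 < zeta.
Proof. by rewrite mulr_gt0// sqrtr_gt0; rewrite mulr_gt0// (lt_le_trans ltr01). Qed.

Let u_zeta : u zeta = ell.
Proof.
rewrite /u /zeta exprMn sqr_sqrtr; last by rewrite mulr_ge0// (le_trans ler01).
by field; rewrite gt_eqF.
Qed.

Let expN_ell : expR (- ell) = t.
Proof. by rewrite /ell div1r lnV// opprK lnK. Qed.

Let u_le y : (u y <= ell) = (`|y| <= zeta).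
Proof.
rewrite -u_zeta /u ler_pM2r ?invr_gt0// -[y ^+ 2]real_normK ?num_real//.
by rewrite ler_pXn2r ?nnegrE// ltW.
Qed.

(* derivative of - y e^{-u(y)} *)
Let tail (y : R) : R := (2 * u y - 1) * expR (- u y).

Let is_derive_u (y : R) : is_derive y 1 (fun y => - u y) (- (y / s ^+ 2)).
Proof.
apply: is_derive_eq; rewrite /GRing.scale/=.
by field; rewrite gt_eqF.
Qed.

Let is_derive_tail (y : R) : is_derive y 1 (fun y => - (y * expR (- u y))) (tail y).
Proof.
have de := is_derive1_comp (is_derive_expR _) (is_derive_u y).
have dm := is_deriveN (is_deriveM (is_derive_id y 1) de).
apply: (is_derive_eq dm); rewrite /GRing.scale/= /tail /u.
by field; rewrite gt_eqF.
Qed.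

Let continuous_tail : continuous tail.
Proof.
have cu : continuous u.
  by move=> y; apply: cvgM; [exact: exprn_continuous|exact: cvg_cst].
move=> y; apply: cvgM.
  by apply: cvgB; [apply: cvgM; [exact: cvg_cst|exact: cu]|exact: cvg_cst].
by apply: continuous_comp; [apply: cvgN; exact: cu|exact: continuous_expR].
Qed.

Let cvgy_tail : - (y * expR (- u y)) @[y --> +oo] --> (0 : R).
Proof.
apply/cvgr0Pnorm_le => e e0; near=> y.
have y0 : 0 < y by near: y; exact: nbhs_pinfty_gt.
have ye : s ^+ 2 *+ 2 / e <= y by near: y; apply: nbhs_pinfty_ge; exact: num_real.
rewrite normrN ger0_norm ?mulr_ge0 ?expR_ge0 ?(ltW y0)//.
rewrite expRN ler_pdivrMr ?expR_gt0//.
apply: (@le_trans _ _ (e * (1 + u y))); last by rewrite ler_pM2l// expR_ge1Dx.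
apply: (@le_trans _ _ (e * u y)); last by rewrite ler_pM2l// lerDr.
rewrite [leRHS](_ : _ = y * (y * e / (s ^+ 2 *+ 2))); last by rewrite /u; ring.
by rewrite ler_peMr ?(ltW y0)// ler_pdivlMr// mul1r -ler_pdivrMr.
Unshelve. all: by end_near. Qed.

Let tail_ge0 y : zeta <= `|y| -> 0 <= tail y /\ 1 + u y <= 2 * (2 * u y - 1).
Proof.
move=> zy.
have uy : ell <= u y.
  rewrite -u_zeta /u ler_pM2r ?invr_gt0// -[y ^+ 2]real_normK ?num_real//.
  by rewrite ler_pXn2r ?nnegrE// ltW.
have h : 1 <= u y := le_trans l1 uy.
by split; [rewrite mulr_ge0 ?expR_ge0//; lra|lra].
Qed.

Let integral_tail : (\int[mu]_(y in `[zeta, +oo[) (tail y)%:E = (zeta * t)%:E)%E.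
Proof.
have h x : zeta <= x -> 0 <= tail x.
  move=> zy; have [] // := @tail_ge0 x _.
  by rewrite ger0_norm// (le_trans (ltW zeta_gt0)).
have := ge0_integral_antiderivativey h continuous_tail is_derive_tail cvgy_tail.
by rewrite sub0r opprK u_zeta expN_ell.
Qed.

Let integral_tailN : (\int[mu]_(y in `]-oo, (- zeta)%R]) (tail y)%:E = (zeta * t)%:E)%E.
Proof.
rewrite ge0_integration_by_substitutionNy.
- rewrite -integral_tail; apply: eq_integral => y _.
  by rewrite /= /tail /u sqrrN.
- exact: continuous_subspaceT.
- move=> y; rewrite in_itv/= => yz; have [] // := @tail_ge0 y _.
  by rewrite ler0_norm 1?lerNr; [exact: ltW|rewrite (le_trans (ltW yz))// oppr_le0 ltW].
Qed.

(** The density of the observation is a multiple of [exp (- u)].  With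
[zeta = s sqrt (2 log (1/t))], on [-zeta, zeta] it cancels the factor [exp u],
leaving a constant of order [t]; outside, [u >= 1] and [(1 + u) exp (- u)] is at
most twice the derivative [(2 u - 1) exp (- u)] of [- y exp (- u)], so that each
tail contributes [zeta exp (- u(zeta)) = zeta t] up to constants. *)
Lemma integral_null_variance_bound :
  (\int[gaussian 0 s]_y (null_variance_bound y)%:E <=
   (1200 * s ^+ 3 * Num.sqrt 2 * normal_peak s * (t * Num.sqrt (ln (1 / t))))%:E)%E.
Proof.
have p0 : 0 < normal_peak s by rewrite normal_peak_gt0// gt_eqF.
have sq0 : 0 <= s ^+ 2 by exact: sqr_ge0.
have mB := measurable_null_variance_bound.
have -> : (\int[gaussian 0 s]_y (null_variance_bound y)%:E =
    \int[mu]_y ((null_variance_bound y)%:E * (normal_pdf 0 s y)%:E))%E.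
  apply: (@ge0_integral_density _ _ _ (gaussian 0 s) mu (normal_pdf 0 s)) => //.
  - exact: normal_pdf_ge0.
  - exact: measurable_normal_pdf.
  - exact/measurable_EFinP.
  - by move=> y; rewrite lee_fin null_variance_bound_ge0.
pose A := 576 * s ^+ 2 * t * normal_peak s.
pose C := 24 * s ^+ 2 * normal_peak s.
have A0 : 0 <= A.
  apply: mulr_ge0; last exact: ltW.
  apply: mulr_ge0; last exact: ltW.
  by apply: mulr_ge0; [exact: ler0n|].
have C0 : 0 <= C by rewrite /C !mulr_ge0// ltW.
have mt : measurable_fun setT (EFin \o tail).
  by apply/measurable_EFinP; exact: continuous_measurable_fun.
have tail0 y : zeta <= y -> (0 <= (tail y)%:E)%E.
  move=> zy; rewrite lee_fin; have [] // := @tail_ge0 y _.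
  by rewrite ger0_norm// (le_trans (ltW zeta_gt0)).
have tailN0 y : y <= - zeta -> (0 <= (tail y)%:E)%E.
  move=> zy; rewrite lee_fin; have [] // := @tail_ge0 y _.
  by rewrite ler0_norm 1?lerNr// (le_trans zy)// oppr_le0 ltW.
pose F1 := (cst A%:E \_ `[- zeta, zeta] : R -> \bar R).
pose F2 := ((fun y => (C%:E * (tail y)%:E)%E) \_ `[zeta, +oo[ : R -> \bar R).
pose F3 := ((fun y => (C%:E * (tail y)%:E)%E) \_ `]-oo, - zeta] : R -> \bar R).
have F10 y : (0 <= F1 y)%E by apply: erestrict_ge0 => z _; rewrite lee_fin.
have F20 y : (0 <= F2 y)%E.
  apply: erestrict_ge0 => z /=; rewrite in_itv/= andbT => zz.
  by rewrite mule_ge0 ?lee_fin// -lee_fin tail0.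
have F30 y : (0 <= F3 y)%E.
  apply: erestrict_ge0 => z /=; rewrite in_itv/= => zz.
  by rewrite mule_ge0 ?lee_fin// -lee_fin tailN0.
have mCt : measurable_fun setT (fun y => (C%:E * (tail y)%:E)%E).
  exact: measurable_funeM.
have mF1 : measurable_fun setT F1.
  exact/(measurable_restrictT _ (measurable_itv _))/measurable_cst.
have mF2 : measurable_fun setT F2.
  exact/(measurable_restrictT _ (measurable_itv _))/measurable_funTS.
have mF3 : measurable_fun setT F3.
  exact/(measurable_restrictT _ (measurable_itv _))/measurable_funTS.
apply: (@le_trans _ _ (\int[mu]_y (F1 y + (F2 y + F3 y)))%E).
  apply: le_integral_of_le => y.
    by rewrite -EFinM lee_fin mulr_ge0 ?normal_pdf_ge0 ?null_variance_bound_ge0.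
  rewrite normal_pdfE ?gt_eqF// /normal_fun subr0 mulNr -/(u y) -EFinM.
  rewrite /null_variance_bound -/(u y) -/ell u_le.
  case: (leP `|y| zeta) => zy.
    apply: (@le_trans _ _ (F1 y)); last by rewrite leeDl// adde_ge0.
    rewrite /F1 patchE mem_set/=; last by rewrite in_itv/= -ler_norml.
    rewrite lee_fin /A expRN; apply: le_of_eq.
    by field; rewrite gt_eqF// expR_gt0.
  have [ty0 uy] := tail_ge0 (ltW zy).
  have key : ((12 * s ^+ 2 * (1 + u y) * (normal_peak s * expR (- u y)))%:E <=
      C%:E * (tail y)%:E)%E.
    rewrite -EFinM lee_fin /C /tail.
    rewrite (_ : 24 * _ * _ * _ = 12 * s ^+ 2 * (2 * (2 * u y - 1)) *
      (normal_peak s * expR (- u y))); last by ring.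
    rewrite ler_wpM2r ?mulr_ge0 ?expR_ge0 ?(ltW p0)//.
    by apply: ler_wpM2l => //; exact: mulr_ge0.
  apply: le_trans key _.
  apply: (@le_trans _ _ (F2 y + F3 y)%E); last by rewrite leeDr.
  have [y0|y0] := leP 0 y.
    apply: (@le_trans _ _ (F2 y)); last by rewrite leeDl.
    rewrite /F2 patchE mem_set//= in_itv/= andbT.
    by rewrite ger0_norm// in zy; exact: ltW.
  apply: (@le_trans _ _ (F3 y)); last by rewrite leeDr.
  rewrite /F3 patchE mem_set//= in_itv/= lerNr.
  by rewrite ltr0_norm// in zy; exact: ltW.
rewrite ge0_integralD//; last 2 first.
- by move=> y _; rewrite adde_ge0.
- exact: emeasurable_funD.
rewrite ge0_integralD// -!integral_mkcond.
rewrite integral_cst//= lebesgue_measure_itv/= lte_fin gtrN// opprK.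
rewrite ge0_integralZl//; last 2 first.
- exact: measurable_funTS.
- by move=> y /=; rewrite in_itv/= andbT; exact: tail0.
rewrite ge0_integralZl//; last exact: measurable_funTS.
rewrite integral_tail integral_tailN -!EFinM -!EFinD lee_fin /A /C /zeta sqrtrM// /ell.
by apply: le_of_eq; ring.
Qed.

End null_signal.

(** * Summation over the coordinates *)

Section risk.
Context (R : realType) (sigma : R) (sigma_gt0 : 0 < sigma).
Local Notation bR := (measurableTypeR R).

Definition signal_factor : R := (12 + 4 * signal_constant R) * sigma ^+ 2.
Definition null_factor : R := 1200 * sigma ^+ 3 * Num.sqrt 2 * normal_peak sigma.

Lemma signal_factor_gt0 : 0 < signal_factor.
Proof.
apply: mulr_gt0; last exact: exprn_gt0.
have := expR_gt0 (1 : R); rewrite /signal_constant; lra.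
Qed.

Lemma null_factor_gt0 : 0 < null_factor.
Proof.
apply: mulr_gt0; last by rewrite normal_peak_gt0// gt_eqF.
apply: mulr_gt0; last by rewrite sqrtr_gt0.
by apply: mulr_gt0; [rewrite ltr0n|exact: exprn_gt0].
Qed.

Lemma integral_posterior_variance_le n (t : R) (theta0 : n.-tuple bR) :
  0 < t < 1 -> 1 <= ln (1 / t) ->
  (\int[gaussian_tuple sigma theta0]_y
     \sum_(i < n) 'V_(horseshoe_posterior sigma t y) [fun theta => tnth theta i] <=
   (\sum_(i < n) if tnth theta0 i != 0 :> R then signal_factor * ln (1 / t)
      else null_factor * (t * Num.sqrt (ln (1 / t))))%:E)%E.
Proof.
move=> /andP[t0 t1] l1.
have t01 : 0 < t <= 1 by rewrite t0 ltW.
have l0 : 0 <= ln (1 / t) by rewrite (le_trans ler01).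
pose B (i : 'I_n) (x : R) : R := if tnth theta0 i != 0 :> R
  then signal_factor * ln (1 / t) else null_variance_bound sigma t x.
have B0 i x : 0 <= B i x.
  rewrite /B; case: ifP => _; last exact: null_variance_bound_ge0.
  by apply: mulr_ge0 => //; exact: ltW signal_factor_gt0.
have mB i : measurable_fun setT (B i).
  rewrite /B; case: (tnth theta0 i != 0) => //.
  exact: measurable_null_variance_bound.
have VB y i : ('V_(horseshoe_posterior sigma t y) [fun theta => tnth theta i] <=
    (B i (tnth y i))%:E)%E.
  rewrite /B; case: ifP => _; first exact: posterior_variance_le_ln.
  rewrite /null_variance_bound; case: ifP => _; first exact: posterior_variance_le_expR.
  exact: posterior_variance_le_sqr.
apply: (@le_trans _ _ (\int[gaussian_tuple sigma theta0]_y
    \sum_(i < n) (B i (tnth y i))%:E)%E).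
  apply: le_integral_of_le => y; first by apply: sume_ge0 => i _; exact: variance_ge0.
  by apply: lee_sum => i _; exact: VB.
rewrite ge0_integral_sum//; last 2 first.
- move=> i; apply/measurable_EFinP.
  exact: (measurableT_comp (mB i) (measurable_tnth i)).
- by move=> i y _; rewrite lee_fin.
rewrite -sumEFin; apply: lee_sum => i _.
have mBE : measurable_fun setT (EFin \o B i) by exact/measurable_EFinP.
rewrite [leLHS](integral_tuple_prob_tnth (fun j => gaussian (tnth theta0 j) sigma)
  i _ mBE); last by move=> x; rewrite /= lee_fin.
rewrite /B /=; have [->|_] := eqVneq (tnth theta0 i : R) 0.
  exact: integral_null_variance_bound.
have := integral_cst (gaussian (tnth theta0 i) sigma) measurableT
  (signal_factor * ln (1 / t))%:E.
rewrite [X in _ = (_ * X)%E](probability_setT (gaussian (tnth theta0 i) sigma)).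
rewrite mule1 => E.
by have := lexx (signal_factor * ln (1 / t))%:E; rewrite -{1}E.
Qed.

(** The rate carries [n - p] null coordinates while there may be more of them; those in
excess of [n - p] are charged to the term [p * ell], as [w <= ell]. *)
Lemma sum_sparse_le n p (P : pred 'I_n) (a b ell w : R) :
  (#|P| <= p)%N -> (p <= n)%N -> 0 <= a -> 0 <= b -> 0 <= w <= ell ->
  \sum_(i < n) (if P i then a * ell else b * w) <=
  (a + b) * (p%:R * ell + (n%:R - p%:R) * w).
Proof.
move=> kp pn a0 b0 /andP[w0 wl].
rewrite (bigID P)/=.
have -> : \sum_(i < n | P i) (if P i then a * ell else b * w) = a * ell * #|P|%:R.
  rewrite (eq_bigr (fun=> a * ell)) ?sumr_const ?mulr_natr// => i Pi.
  by rewrite ifT.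
have -> : \sum_(i < n | ~~ P i) (if P i then a * ell else b * w) =
    b * w * #|[pred i | ~~ P i]|%:R.
  rewrite (eq_bigr (fun=> b * w)) ?sumr_const ?mulr_natr// => i Pi.
  by rewrite ifN.
have kn : (#|P| <= n)%N := leq_trans kp pn.
have -> : #|[pred i | ~~ P i]| = (n - #|P|)%N.
  apply: (@addnI #|P|); rewrite subnKC//; have := cardC P; rewrite card_ord; exact.
rewrite natrB//.
have : #|P|%:R <= p%:R :> R by rewrite ler_nat.
have : p%:R <= n%:R :> R by rewrite ler_nat.
have : 0 <= #|P|%:R :> R by [].
move: (#|P|%:R) (p%:R) (n%:R) => k q m k0 qm kq.
have l0 : 0 <= ell := le_trans w0 wl.
have h1 : a * ell * k <= a * ell * q by rewrite ler_wpM2l// mulr_ge0.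
have h2 : b * w * (q - k) <= b * ell * q.
  apply: (@le_trans _ _ (b * ell * (q - k))).
    by rewrite ler_wpM2r ?subr_ge0// ler_wpM2l.
  by rewrite ler_wpM2l ?mulr_ge0//; lra.
have h3 : 0 <= a * ((m - q) * w) by rewrite mulr_ge0// mulr_ge0// subr_ge0.
by lra.
Qed.

End risk.

Theorem theorem3p2 (R : realType) (sigma : R) (p : nat -> nat) (tau : nat -> R)
    (sigma_gt0 : 0 < sigma)
    (p_le : forall n, (p n <= n)%N)
    (p_infty : p @ \oo --> \oo)
    (p_littleo : (fun n => (p n)%:R : R) =o_\oo (fun n => n%:R : R))
    (tau01 : forall n, 0 < tau n < 1)
    (tau_to0 : tau @ \oo --> (0 : R)) :
  exists2 c : R, 0 < c & \forall n \near \oo,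
    (ereal_sup
      [set \int[gaussian_tuple sigma theta0]_y
             \sum_(i < n) 'V_(horseshoe_posterior sigma (tau n) y)
                             [fun theta => tnth theta i]
      | theta0 in @ell0 R n (p n)]
    <= (c * ((p n)%:R * ln (1 / tau n) +
             (n%:R - (p n)%:R) * tau n * Num.sqrt (ln (1 / tau n))))%:E)%E.
Proof.
have a0 := signal_factor_gt0 sigma_gt0; have b0 := null_factor_gt0 sigma_gt0.
exists (signal_factor sigma + null_factor sigma); first exact: addr_gt0.
(* makes log (1/tau) at least 1, hence tau sqrt (log (1/tau)) <= log (1/tau) *)
have tau_small : \forall n \near \oo, tau n <= expR (-1).
  have /cvgr0Pnorm_le/(_ _ (expR_gt0 (-1))) := tau_to0.
  by apply: filterS => n; apply: le_trans; exact: ler_norm.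
near=> n.
have /andP[t0 t1] := tau01 n.
have l1 : 1 <= ln (1 / tau n).
  rewrite div1r lnV// lerNr -[leRHS]expRK ler_ln ?posrE ?expR_gt0//.
  by near: n.
have l0 : 0 <= ln (1 / tau n) by rewrite (le_trans ler01).
apply: ub_ereal_sup => _ [theta0 /= theta0p <-].
apply: le_trans (integral_posterior_variance_le sigma_gt0 _ (tau01 n) l1) _.
rewrite lee_fin -mulrA.
apply: (@sum_sparse_le _ _ _ (fun i => tnth theta0 i != 0 :> R)) => //; try exact: ltW.
apply/andP; split; first by rewrite mulr_ge0 ?sqrtr_ge0// ltW.
have q0 := sqrtr_ge0 (ln (1 / tau n)).
have qE : Num.sqrt (ln (1 / tau n)) ^+ 2 = ln (1 / tau n) by rewrite sqr_sqrtr.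
have q1 : 1 <= Num.sqrt (ln (1 / tau n)) by rewrite -[leLHS]sqrtr1 ler_wsqrtr.
rewrite -[leRHS]qE expr2; apply: ler_wpM2r => //.
exact: le_trans (ltW t1) q1.
Unshelve. all: by end_near. Qed.
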